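(* Let $(\Pi(\Theta),\Pi(\Phi))$ be a standard partition, with $\Pi(\Theta)=\{\Theta_1,\dots,\Theta_{N_\Theta}\}$ and $\Pi(\Phi)=\{\Phi_{j,i}: 1\le j\le N_\Theta, 1\le i\le N_r\}$, and ratio $\beta>1$. Let $\hat Y_f=\{\hat Y_{f,\theta}\}_{\theta\in\Pi(\Theta)}$ and $\hat Y_H=\{\hat Y_{H,\phi}\}_{\phi\in\Pi(\Phi)}$ be the mean-summaries of two (unknown) Bernoulli fields in $\Pi(\Theta)$ and $\Pi(\Phi)$, respectively. For each $j$ and each $0\le k\le N_r$ let $\psi_{j,k}$ be the set of indices $i$ of the $k$ largest elements of $\{\hat Y_{H,\Phi_{j,1}},\dots,\hat Y_{H,\Phi_{j,N_r}}\}$ (ties broken arbitrarily), and let $\Psi_{j,k}\triangleq\sum_{i\in\psi_{j,k}}\hat Y_{H,\Phi_{j,i}}$. Then, for any Bernoulli field $B_f$ on $\Theta$ with mean-summary $\hat Y_f$ and any Bernoulli field $B_H$ on $\Phi$ with mean-summary $\hat Y_H$, the evidence satisfies $L(H)\ge\underline{L}_{\mathbf{\Pi}}(H)$, where $$\underline{L}_{\mathbf{\Pi}}(H)\triangleq\frac{\lambda Z_{B_H}}{|J(T)|}+\sum_{j=1}^{N_\Theta}\underline{\mathcal{L}}_{\Theta_j}(H),$$ $$\underline{\mathcal{L}}_{\Theta_j}(H)\triangleq\max_{0\le \mathsf{n}_j\le N_r}\left\{\max_{\mathsf{q}\in\{0,1\}}\Big[\mathsf{q}\,\hat Y_{f,\Theta_j}+|\Theta_j|\log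 P\big(\mathsf{q}\,|\,\mathsf{n}_j\log\beta\big)\Big]+\frac{\lambda}{|J(T)|}\Psi_{j,\mathsf{n}_j}\right\}$$ (the outer maximum being over integers $\mathsf{n}_j$). Moreover, let $\mathsf{n}_j^*$ be a maximizer of the outer maximum defining $\underline{\mathcal{L}}_{\Theta_j}(H)$, and define discrete shapes $\hat v$ on $\Pi(\Phi)$ and $\hat q$ on $\Pi(\Theta)$ by $$\hat v(\Phi_{j,i})\triangleq\begin{cases}1,& i\in\psi_{j,\mathsf{n}_j^*},\\0,&\text{otherwise,}\end{cases}\qquad \hat q(\Theta_j)\triangleq\operatorname*{arg\,max}_{\mathsf{q}\in\{0,1\}}\Big[\mathsf{q}\,\hat Y_{f,\Theta_j}+|\Theta_j|\log P\big(\mathsf{q}\,|\,\mathsf{n}^*_j\log\beta\big)\Big].$$ Then $\hat v$ and $\hat q$ are the 3D reconstruction and 2D segmentation corresponding to this bound, i.e. the continuous shapes $q$, $v$ produced from $\hat q$, $\hat v$ satisfy $E(q,v)=\underline{L}_{\mathbf{\Pi}}(H)$, where $E$ is the functional whose supremum is $L(H)$.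
   Context: Setting. $\vec{c}\in\mathbb{R}^3$ is the camera center, $\Theta\subset S^2$ (with solid-angle measure $d\vec{x}$), $0<R_{min}<R_{max}$, and $\Phi=\{\vec{c}+r\vec{x}:\vec{x}\in\Theta,\ R_{min}\le r\le R_{max}\}\subset\mathbb{R}^3$, with points written $(\vec{x},r)$ and Lebesgue measure $r^2\,dr\,d\vec{x}$; $\Phi$ is identified with $\Theta\times[R_{min},R_{max}]$. $|\cdot|$ of a set denotes its measure. Continuous shapes. A continuous shape in $\Omega$ is an open set $s\subset\Omega$ with boundary of measure zero, identified with its indicator $s:\Omega\to\{0,1\}$; shapes are considered up to sets of measure zero. A discrete shape on a partition $\Pi(\Omega)$ is a function $\hat s:\Pi(\Omega)\to\{0,1\}$; it produces the continuous shape $s$ with $s(\vec{x})=\hat s(\omega)$ for $\vec{x}\in\omega\in\Pi(\Omega)$. Partition elements are measurable with boundary of measure zero. Bernoulli fields. A (continuous) Bernoulli field $B$ on $\Omega$ is given by measurable success rates $p_B:\Omega\to(0,1)$; its logit function is $\delta_B=\log\frac{p_B}{1-p_B}$, assumed bounded, and $Z_B=\int_\Omega\log(1-p_B(\vec{x}))\,d\vec{x}$. The mean-summary of $B$ in a partition $\Pi(\Omega)$ is $\{\hat Y_{B,\omega}\}_{\omega\in\Pi(\Omega)}$ with $\hat Y_{B,\omega}=\int_\omega\delta_B(\vec{x})\,d\vec{x}$. Standard partition. $\Pi(\Theta)=\{\Theta_1,\dots,\Theta_{N_\Theta}\}$ is a partition of $\Theta$; $R_{min}=r_0<r_1<\dots<r_{N_r}=R_{max}$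 with $r_i=\beta r_{i-1}$ for some $\beta>1$; $\Pi(\Phi)$ consists of $\Phi_{j,i}=\Theta_j\times[r_{i-1},r_i)$. The standard partition is $\mathbf{\Pi}=(\Pi(\Theta),\Pi(\Phi))$. Projection term. For a 3D continuous shape $v$ in $\Phi$, $\ell_v(\vec{x})=\int_{R_{min}}^{R_{max}}\frac{v(\vec{x},r)}{r}\,dr$. For a fixed $\alpha<0$ and $\ell\ge0$, $\log P(\mathsf{q}\,|\,\ell)=\alpha\ell$ if $\mathsf{q}=0$ and $\log P(\mathsf{q}\,|\,\ell)=\log(1-e^{\alpha\ell})$ if $\mathsf{q}=1$, with $\log 0=-\infty$ and $0\cdot(-\infty)=0$. Evidence. $H=(K,T)$ is a hypothesis, $T:\mathbb{R}^3\to\mathbb{R}^3$ a transformation with Jacobian constant $|J(T)|>0$, and $\lambda>0$ a constant. Given Bernoulli fields $B_f$ on $\Theta$ and $B_H$ on $\Phi$, the evidence is $L(H)=\sup_{q,v}E(q,v)$, the supremum being over continuous shapes $q$ in $\Theta$ and $v$ in $\Phi$, where $$E(q,v)=\int_\Theta\Big[q(\vec{x})\delta_{B_f}(\vec{x})+\log P(q(\vec{x})|\ell_v(\vec{x}))+\frac{\lambda}{|J(T)|}\int_{R_{min}}^{R_{max}}r^2v(\vec{x},r)\delta_{B_H}(\vec{x},r)\,dr\Big]d\vec{x}+\frac{\lambda Z_{B_H}}{|J(T)|}.$$ *)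

(* Defs.v *)
From HB Require Import structures.
From mathcomp Require Import all_boot all_order all_algebra.
From mathcomp Require Import all_classical all_reals all_analysis.
From mathcomp Require Import measurable_realfun.

Set Implicit Arguments.
Unset Strict Implicit.
Unset Printing Implicit Defensive.

Import Order.TTheory GRing.Theory Num.Theory.
Import numFieldNormedType.Exports.

Local Open Scope classical_set_scope.
Local Open Scope ring_scope.

(* Real 3-space as a product: unlike ['rV[R]_3], it carries at once the
   library's topology, sigma-algebra and differential structure.  The library
   norm on it is the sup norm, hence [enorm]. *)
Notation R3 R := (R * R * R)%type.

Definition enorm (R : realType) (x : R3 R) : R :=
  Num.sqrt (x.1.1 ^+ 2 + x.1.2 ^+ 2 + x.2 ^+ 2).

Definition S2 (R : realType) : set (R3 R) := [set x | enorm x = 1].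

Definition leb3 (R : realType) (A : set (R3 R)) : \bar R :=
  ((@lebesgue_measure R \x @lebesgue_measure R) \x @lebesgue_measure R)%E A.

HB.instance Definition _ (R : realType) :=
  isMeasure.Build _ _ _ (@leb3 R)
    (measure0 ((@lebesgue_measure R \x @lebesgue_measure R)
      \x @lebesgue_measure R)%E)
    (measure_ge0 ((@lebesgue_measure R \x @lebesgue_measure R)
      \x @lebesgue_measure R)%E)
    (@measure_semi_sigma_additive _ _ _
      ((@lebesgue_measure R \x @lebesgue_measure R) \x @lebesgue_measure R)%E).

Definition direction (R : realType) (y : R3 R) : R3 R := (enorm y)^-1 *: y.

Definition cone (R : realType) (A : set (R3 R)) : set (R3 R) :=
  [set y | 0 < enorm y <= 1 /\ A (direction y)].

(* Solid angle: three times the volume of the cone over [A] in the unit ball,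
   i.e. the measure dx on the sphere for which Lebesgue measure is r^2 dr dx.
   As a measure on 3-space it is concentrated on [S2]. *)
Definition solid_angle (R : realType) (A : set (R3 R)) : \bar R :=
  (3%:E * leb3 (cone A))%E.

Section solid_angle_measure.
Local Open Scope ereal_scope.
Context (R : realType).

Let measurable_x1 : measurable_fun [set: R3 R] (fun x => x.1.1).
Proof. by apply: (measurableT_comp measurable_fst); exact: measurable_fst. Qed.

Let measurable_x2 : measurable_fun [set: R3 R] (fun x => x.1.2).
Proof. by apply: (measurableT_comp measurable_snd); exact: measurable_fst. Qed.

Let measurable_x3 : measurable_fun [set: R3 R] (fun x => x.2).
Proof. exact: measurable_snd. Qed.

Lemma measurable_enorm : measurable_fun [set: R3 R] (@enorm R).
Proof.
apply: (@measurableT_comp _ _ _ _ _ _ (@Num.sqrt R)).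
  by apply: continuous_measurable_fun; exact: sqrt_continuous.
apply: measurable_funD; first apply: measurable_funD.
- exact: measurable_funX measurable_x1.
- exact: measurable_funX measurable_x2.
- exact: measurable_funX measurable_x3.
Qed.

Lemma measurable_direction : measurable_fun [set: R3 R] (@direction R).
Proof.
have mV : measurable_fun [set: R3 R] (fun y => (enorm y)^-1%R).
  have -> : (fun y => (enorm y)^-1%R) = (fun y : R3 R => (enorm y `^ (-1))%R).
    by apply/funext => y; rewrite powR_inv1// sqrtr_ge0.
  apply: (measurableT_comp (measurable_powR (-1))); exact: measurable_enorm.
apply/measurable_fun_pairP; split; first apply/measurable_fun_pairP; try split.
- exact: (measurable_funM mV measurable_x1).
- exact: (measurable_funM mV measurable_x2).
- exact: (measurable_funM mV measurable_x3).
Qed.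

Lemma measurable_cone (A : set (R3 R)) : measurable A -> measurable (cone A).
Proof.
move=> mA.
have -> : cone A = (@enorm R @^-1` [set` `]0%R, 1%R]]) `&` (@direction R @^-1` A).
  by apply/seteqP; split=> y /=; rewrite in_itv.
apply: measurableI.
  by rewrite -[X in measurable X]setTI; apply: measurable_enorm.
by rewrite -[X in measurable X]setTI; apply: measurable_direction.
Qed.

Let solid_angle0 : solid_angle (@set0 (R3 R)) = 0.
Proof.
have -> : solid_angle (@set0 (R3 R)) = 3%:E * leb3 (@set0 (R3 R)).
  by congr (_ * leb3 _); apply/seteqP; split=> y // [].
by rewrite measure0 mule0.
Qed.

Let solid_angle_ge0 (A : set (R3 R)) : 0 <= solid_angle A.
Proof. by rewrite mule_ge0// lee_fin. Qed.

Let solid_angle_sigma_additive : semi_sigma_additive (@solid_angle R).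
Proof.
move=> F mF tF mUF.
rewrite [X in X @ \oo --> _](_ : _ =
    (fun n => 3%:E * \sum_(0 <= i < n) leb3 (cone (F i)))); last first.
  by apply/funext => k; rewrite ge0_sume_distrr.
apply: cvgeZl => //.
have -> : cone (\bigcup_n F n) = \bigcup_n cone (F n).
  apply/seteqP; split=> [y [y1 [n _ Fn]]|y [n _ [y1 Fn]]].
    by exists n.
  by split=> //; exists n.
apply: measure_sigma_additive.
  by move=> n; exact: measurable_cone.
apply/trivIsetP => i j _ _ ij; apply/seteqP; split=> // y [[_ Fi] [_ Fj]].
by have /seteqP[/(_ (direction y)) + _] := (trivIsetP.1 tF) i j I I ij; apply.
Qed.

HB.instance Definition _ := isMeasure.Build _ _ _ (@solid_angle R)
  solid_angle0 solid_angle_ge0 solid_angle_sigma_additive.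

End solid_angle_measure.

Definition boundary (T : topologicalType) (A : set T) : set T :=
  closure A `\` A°.

Definition boundary_S2 (R : realType) (A : set (R3 R)) : set (R3 R) :=
  @boundary (subspace (@S2 R)) A.

(* "Open" and "boundary" are those of the ambient space: the sphere for
   2D shapes, 3-space for 3D shapes. *)
Definition shape2D (R : realType) (Theta q : set (R3 R)) : Prop :=
  [/\ @open (subspace (@S2 R)) q, q `<=` Theta
    & (@solid_angle R).-negligible (boundary_S2 q)].

Definition shape3D (R : realType) (Phi v : set (R3 R)) : Prop :=
  [/\ open v, v `<=` Phi & (@leb3 R).-negligible (boundary v)].

Definition frustum (R : realType) (c : R3 R) (A : set (R3 R)) (I : set R) :
    set (R3 R) :=
  [set c + r *: x | x in A & r in I].

Definition field_of_view (R : realType) (c : R3 R) (Theta : set (R3 R))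
    (Rmin Rmax : R) : set (R3 R) :=
  frustum c Theta `[Rmin, Rmax].

(* [rad i] is r_i for i <= Nr; later values are irrelevant.  The cell of
   indices (j, i), with i : 'I_Nr counted from 0, is [cell c Th rad j i]. *)
Record standard_partition (R : realType) (Theta : set (R3 R)) (Rmin Rmax : R)
    (NTheta : nat) (Th : 'I_NTheta -> set (R3 R)) (Nr : nat) (rad : nat -> R)
    (beta : R) : Prop := StandardPartition {
  sp_partition : classical_sets.partition [set: 'I_NTheta] Th Theta;
  sp_measurable : forall j, measurable (Th j);
  sp_boundary : forall j, (@solid_angle R).-negligible (boundary_S2 (Th j));
  sp_first : rad 0%N = Rmin;
  sp_last : rad Nr = Rmax;
  sp_increasing : forall i, (i < Nr)%N -> rad i < rad i.+1;
  sp_beta : 1 < beta;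
  sp_ratio : forall i, (i < Nr)%N -> rad i.+1 = beta * rad i }.

Definition cell (R : realType) (c : R3 R) (NTheta Nr : nat)
    (Th : 'I_NTheta -> set (R3 R)) (rad : nat -> R) (j : 'I_NTheta)
    (i : 'I_Nr) : set (R3 R) :=
  frustum c (Th j) `[rad i, rad i.+1[.

(* Shapes are considered up to null sets, so a discrete shape determines its
   continuous shape only almost everywhere. *)
Definition produces2D (R : realType) (Theta : set (R3 R)) (NTheta : nat)
    (Th : 'I_NTheta -> set (R3 R)) (qhat : 'I_NTheta -> bool)
    (q : set (R3 R)) : Prop :=
  shape2D Theta q /\
  {ae @solid_angle R, forall x, forall j, Th j x -> (x \in q) = qhat j}.

Definition produces3D (R : realType) (Phi : set (R3 R)) (c : R3 R)
    (NTheta Nr : nat) (Th : 'I_NTheta -> set (R3 R)) (rad : nat -> R)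
    (vhat : 'I_NTheta -> 'I_Nr -> bool) (v : set (R3 R)) : Prop :=
  shape3D Phi v /\
  {ae @leb3 R, forall y, forall j i, cell c Th rad j i y ->
     (y \in v) = vhat j i}.

Definition logit (R : realType) (p : R3 R -> R) (x : R3 R) : R :=
  ln (p x / (1 - p x)).

Record bernoulli_field (R : realType) (Omega : set (R3 R)) := BernoulliField {
  rate :> R3 R -> R;
  measurable_rate : measurable_fun Omega rate;
  rate_in01 : forall x, Omega x -> 0 < rate x < 1;
  bounded_logit : [bounded logit rate x | x in Omega] }.

Definition mean_summary (R : realType) (mu : {measure set (R3 R) -> \bar R})
    (Omega : set (R3 R)) (B : bernoulli_field Omega) (w : set (R3 R)) : R :=
  \int[mu]_(x in w) logit B x.

Definition log_normalizer (R : realType) (mu : {measure set (R3 R) -> \bar R})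
    (Omega : set (R3 R)) (B : bernoulli_field Omega) : R :=
  \int[mu]_(x in Omega) ln (1 - B x).

(* [T] is meant to be differentiable; the (i, j) entry is dT_i / dx_j. *)
Definition jacobian_det (R : realType) (T : R3 R -> R3 R) (x : R3 R) : R :=
  let coord (y : R3 R) (i : 'I_3) : R := [:: y.1.1; y.1.2; y.2]`_i in
  let basis (j : 'I_3) : R3 R :=
    ((j == 0 :> nat)%:R, (j == 1%N :> nat)%:R, (j == 2%N :> nat)%:R) in
  \det (\matrix_(i < 3, j < 3) coord ('D_(basis j) T x) i).

Definition constant_jacobian (R : realType) (T : R3 R -> R3 R) (J : R) : Prop :=
  forall x, differentiable T x /\ `|jacobian_det T x| = J.

Definition path_length (R : realType) (c : R3 R) (Rmin Rmax : R)
    (v : set (R3 R)) (x : R3 R) : R :=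
  \int[@lebesgue_measure R]_(r in `[Rmin, Rmax]) (\1_v (c + r *: x) / r).

Definition log_proj (R : realType) (alpha : R) (q : bool) (l : R) : \bar R :=
  if q then lne (1 - expR (alpha * l))%:E else (alpha * l)%:E.

(* E(q, v); [J] stands for |J(T)|. *)
Definition score (R : realType) (c : R3 R) (Theta : set (R3 R))
    (Rmin Rmax alpha lam J : R) (Bf : bernoulli_field Theta)
    (BH : bernoulli_field (field_of_view c Theta Rmin Rmax))
    (q v : set (R3 R)) : \bar R :=
  (\int[@solid_angle R]_(x in Theta)
      ((\1_q x * logit Bf x)%:E
       + log_proj alpha (x \in q) (path_length c Rmin Rmax v x)
       + (lam / J * \int[@lebesgue_measure R]_(r in `[Rmin, Rmax])
            (r ^+ 2 * \1_v (c + r *: x) * logit BH (c + r *: x)))%R%:E)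
   + (lam * log_normalizer (@leb3 R) BH / J)%:E)%E.

Definition evidence (R : realType) (c : R3 R) (Theta : set (R3 R))
    (Rmin Rmax alpha lam J : R) (Bf : bernoulli_field Theta)
    (BH : bernoulli_field (field_of_view c Theta Rmin Rmax)) : \bar R :=
  ereal_sup [set e | exists q v,
    [/\ shape2D Theta q, shape3D (field_of_view c Theta Rmin Rmax) v
      & e = score alpha lam J Bf BH q v]].

Definition k_largest (R : realType) (n : nat) (Y : 'I_n -> R) (k : nat)
    (A : {set 'I_n}) : Prop :=
  #|A| = k /\ forall i i', i \in A -> i' \notin A -> Y i' <= Y i.

(* q * Y_f + |Theta_j| log P(q | n log beta), with [m] for |Theta_j|;
   multiplication in [\bar R] satisfies 0 * -oo = 0. *)
Definition projection_gain (R : realType) (alpha beta : R) (m : \bar R) (Y : R)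
    (n : nat) (q : bool) : \bar R :=
  ((q%:R * Y)%:E + m * log_proj alpha q (n%:R * ln beta))%E.

Definition region_gain (R : realType) (alpha beta lam J : R) (m : \bar R)
    (Y : R) (Nr : nat) (YH : 'I_Nr -> R) (psi : 'I_Nr.+1 -> {set 'I_Nr})
    (n : 'I_Nr.+1) : \bar R :=
  (\big[maxe/-oo]_(q : bool) projection_gain alpha beta m Y n q
   + (lam / J * \sum_(i in psi n) YH i)%R%:E)%E.

Definition region_bound (R : realType) (alpha beta lam J : R) (m : \bar R)
    (Y : R) (Nr : nat) (YH : 'I_Nr -> R) (psi : 'I_Nr.+1 -> {set 'I_Nr}) :
    \bar R :=
  (\big[maxe/-oo]_(n < Nr.+1) region_gain alpha beta lam J m Y YH psi n)%E.

Definition lower_bound (R : realType) (alpha beta lam J Z : R)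
    (NTheta Nr : nat) (Th : 'I_NTheta -> set (R3 R)) (Yf : 'I_NTheta -> R)
    (YH : 'I_NTheta -> 'I_Nr -> R)
    (psi : 'I_NTheta -> 'I_Nr.+1 -> {set 'I_Nr}) : \bar R :=
  ((lam * Z / J)%:E
   + \sum_(j < NTheta)
       region_bound alpha beta lam J (solid_angle (Th j)) (Yf j) (YH j) (psi j))%E.

(* Main.v *)
(* A discrete shape is constant on the cells, so for almost every direction x in
   Theta_j the ray through x meets the reconstruction exactly in the cells (j, i)
   with vhat(j, i) = 1; as r_i = beta r_(i-1), each of them contributes ln beta to
   the path length, and the score integrates, cell by cell, to the expression
   maximized in the lower bound.  Integrals over a cell are iterated integrals
   by polar coordinates: the solid angle being defined by volumes of cones,
   dy = r^2 dr dx on sectors is the scaling property of Lebesgue measure, and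
   uniqueness of measures extends it to all measurable sets.  The continuous
   shapes are the unions of the interiors of the selected cells; their boundaries
   lie in finitely many spheres and cones over null sets. *)
Require Import Defs.
From HB Require Import structures.
From mathcomp Require Import all_boot all_order all_algebra.
From mathcomp Require Import all_classical all_reals all_analysis.
From mathcomp Require Import unstable measurable_realfun ring lra.
Set Implicit Arguments.
Unset Strict Implicit.
Unset Printing Implicit Defensive.
Import Order.TTheory GRing.Theory Num.Theory.
Import numFieldNormedType.Exports.
Local Open Scope classical_set_scope.
Local Open Scope ring_scope.

(** * Scaling of Lebesgue measure *)

Section affine_change_of_variables.
Local Open Scope ereal_scope.

(** Two obstacles shape the proof. First, the score takes values in the extended reals, since log
    P(1 | 0) = -oo. A maximizing [qhat] avoids this value on every cell of positive solid angle,
    because q = 0 always has a finite gain; on a null cell the bound has 0 * -oo = 0 and the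
    integral sees nothing. Hence on each cell a real-valued integrand suffices. Second, a discrete
    shape fixes its continuous shape only up to a null set, and the equality with the bound is
    proved for every produced pair. A null set of 3-space must therefore be turned into null sets of
    radii on almost every ray, and the integrand of the score, known only almost everywhere, must be
    replaced by one that is integrable on each cell. Polar coordinates are set up with r^2 dr cut
    off to a bounded interval ]0, b]: the measures involved are then finite, and bounded measurable
    functions are integrable. The inequality for the evidence is a consequence of the equality: the
    bound is a value of the functional at an admissible pair. *)

Lemma lebesgue_measure_affine {R : realType} (s a : R) (A : set R) :
  (0 < s)%R -> measurable A ->
  lebesgue_measure ((fun x => s * (x - a))%R @^-1` A) =
    s^-1%:E * lebesgue_measure A.
Proof.
move=> s0 mA.
have mg : measurable_fun [set: R]
    ((fun x => s * (x - a))%R : R -> measurableTypeR R).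
  by apply: measurable_funM => //; exact: measurable_funB.
have s0' : (0 <= s)%R by exact: ltW.
pose k : {nonneg R} := NngNum s0'.
rewrite (@lebesgue_measure_unique R (mscale k (pushforward lebesgue_measure
    ((fun x => s * (x - a))%R : R -> measurableTypeR R))) _ A mA).
  by rewrite /mscale/= /pushforward muleA -EFinM mulVf ?gt_eqF// mul1e.
move=> _ [[x y] _ <-] /=; rewrite /mscale/= /pushforward.
rewrite (_ : _ @^-1` _ = `](x / s + a)%R, (y / s + a)%R]%classic); last first.
  apply/seteqP; split=> z /=; rewrite !in_itv/= -ltrBrDr -lerBlDr.
    move=> /andP[? ?]; rewrite ltr_pdivrMr// ler_pdivlMr//.
    by rewrite ![((_ - _) * s)%R]mulrC; apply/andP.
  by rewrite ltr_pdivrMr// ler_pdivlMr// ![((_ - _) * s)%R]mulrC.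
rewrite !lebesgue_measure_itv/= !lte_fin ltrD2r ltr_pM2r ?invr_gt0//.
case: ifPn => _; last by rewrite mule0.
by rewrite -!EFinB -EFinM; congr EFin; field; rewrite gt_eqF.
Qed.

(** Slicing: [g2] scales each section by [k2], and pushing [m1] forward along [g1] gives [k1] times
    [m1]. The measures are abstract so that the lemma can be applied twice, going from dimension 1
    to 2 and then to 3. *)
Lemma product_measure_scaling d1 d2 (T1 : measurableType d1)
    (T2 : measurableType d2) (R : realType)
    (m1 : {measure set T1 -> \bar R}) (m2 : {sigma_finite_measure set T2 -> \bar R})
    (g1 : T1 -> T1) (g2 : T2 -> T2) (k1 k2 : R) :
  (0 <= k1)%R -> (0 <= k2)%R -> measurable_fun [set: T1] g1 ->
  (forall A, measurable A -> m1 (g1 @^-1` A) = k1%:E * m1 A) ->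
  (forall A, measurable A -> m2 (g2 @^-1` A) = k2%:E * m2 A) ->
  forall X, measurable X ->
  (m1 \x m2) ((fun z => (g1 z.1, g2 z.2)) @^-1` X) =
    (k1 * k2)%:E * (m1 \x m2) X.
Proof.
move=> k10 k20 mg1 g1E g2E X mX.
pose h := m2 \o xsection X.
have mh : measurable_fun setT h by exact: measurable_fun_xsection.
transitivity (\int[m1]_x (k2%:E * h (g1 x))).
  apply: eq_integral => x _ /=; rewrite -g2E; last exact: measurable_xsection.
  congr (m2 _); apply/seteqP; split=> y; rewrite /xsection/= !inE//.
rewrite ge0_integralZl//; last exact: (measurableT_comp mh mg1).
rewrite -(@ge0_integral_pushforward _ _ _ _ _ g1 mg1 m1 setT h)//.
pose k : {nonneg R} := NngNum k10.
rewrite (eq_measure_integral (mscale k m1)).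
  rewrite ge0_integral_mscale//= -[in RHS](mulrC k2) EFinM muleA//.
by move=> A mA _; exact: g1E.
Qed.

Lemma leb3_affine {R : realType} (s : R) (c : R3 R) (X : set (R3 R)) :
  (0 < s)%R -> measurable X ->
  leb3 ((fun y => s *: (y - c)) @^-1` X) = (s ^- 3)%:E * leb3 X.
Proof.
move=> s0 mX; have si : (0 < s^-1)%R by rewrite invr_gt0.
have mg (a : R) : measurable_fun [set: measurableTypeR R]
    ((fun x => s * (x - a))%R : measurableTypeR R -> measurableTypeR R).
  by apply: measurable_funM => //; exact: measurable_funB.
have mg2 : measurable_fun [set: measurableTypeR R * measurableTypeR R]
    (fun z => ((s * (z.1 - c.1.1))%R, (s * (z.2 - c.1.2))%R)).
  apply/measurable_fun_pairP; split.
    exact: (measurableT_comp (mg c.1.1) measurable_fst).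
  exact: (measurableT_comp (mg c.1.2) measurable_snd).
pose lam := @lebesgue_measure R.
have E2 := @product_measure_scaling _ _ _ _ _ lam lam _ _ _ _
  (ltW si) (ltW si)
  (mg c.1.1)
  (fun A mA => lebesgue_measure_affine c.1.1 s0 mA)
  (fun A mA => lebesgue_measure_affine c.1.2 s0 mA).
have E3 := @product_measure_scaling _ _ _ _ _ (lam \x lam) lam _ _ _ _
  (mulr_ge0 (ltW si) (ltW si)) (ltW si) mg2 E2
  (fun A mA => lebesgue_measure_affine c.2 s0 mA) X mX.
rewrite /leb3 -[RHS]/((s ^- 3)%:E * (lam \x lam \x lam) X).
rewrite (_ : s ^- 3 = s^-1 * s^-1 * s^-1)%R; last first.
  by rewrite -exprVn !exprS expr0 mulr1 mulrA.
by rewrite -E3.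
Qed.

End affine_change_of_variables.

(** * Euclidean norm, solid angle and radial measure *)

Section euclidean_norm.
Context {R : realType}.
Implicit Types (x y : R3 R) (s r : R).

Lemma enormZ s y : 0 <= s -> enorm (s *: y) = s * enorm y.
Proof.
move: y => [[y1 y2] y3] s0; rewrite /enorm/= /GRing.scale/=.
rewrite (_ : _ + _ = s ^+ 2 * (y1 ^+ 2 + y2 ^+ 2 + y3 ^+ 2)); last by ring.
by rewrite sqrtrM ?sqr_ge0// sqrtr_sqr ger0_norm.
Qed.

Lemma directionZ s y : 0 < s -> direction (s *: y) = direction y.
Proof.
move=> s0; rewrite /direction enormZ ?ltW// scalerA; congr (_ *: _).
by rewrite invfM mulrC mulrA mulfV ?gt_eqF// mul1r.
Qed.

Lemma enorm_direction y : 0 < enorm y -> enorm (direction y) = 1.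
Proof.
by move=> y0; rewrite enormZ ?invr_ge0 ?ltW// mulVf// gt_eqF.
Qed.

Lemma scale_direction y : 0 < enorm y -> enorm y *: direction y = y.
Proof. by move=> y0; rewrite scalerA mulfV ?gt_eqF// scale1r. Qed.

Lemma enorm_ray x r : S2 x -> 0 <= r -> enorm (r *: x) = r.
Proof. by move=> x1 r0; rewrite enormZ// x1 mulr1. Qed.

Lemma direction_ray x r : S2 x -> 0 < r -> direction (r *: x) = x.
Proof. by move=> x1 r0; rewrite directionZ// /direction x1 invr1 scale1r. Qed.

End euclidean_norm.

Section solid_angle_finite.
Local Open Scope ereal_scope.
Context (R : realType).

Lemma leb3_cone_lty (A : set (R3 R)) : measurable A -> leb3 (cone A) < +oo.
Proof.
move=> mA; pose I : set R := `[(-1)%R, 1%R]%classic.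
have mI : measurable I by exact: measurable_itv.
apply: (@le_lt_trans _ _ (leb3 (I `*` I `*` I))).
  apply: le_measure; rewrite ?inE.
  - exact: measurable_cone.
  - by apply: measurableX => //; exact: measurableX.
  move=> [[y1 y2] y3] [/= /andP[_ y1le] _].
  have : (y1 ^+ 2 + y2 ^+ 2 + y3 ^+ 2 <= 1)%R.
    rewrite -[leRHS](expr1n _ 2) -ler_sqrt ?sqr_ge0//.
    by rewrite sqrtr_sqr normr1.
  move=> y1le'; rewrite /I /= !in_itv/=.
  have [h1 h2 h3] : [/\ 0 <= y1 ^+ 2, 0 <= y2 ^+ 2 & 0 <= y3 ^+ 2]%R.
    by rewrite !sqr_ge0.
  by do !split; apply/andP; split; nra.
have -> : leb3 (I `*` I `*` I) =
    lebesgue_measure I * lebesgue_measure I * lebesgue_measure I.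
  pose lam := @lebesgue_measure R.
  transitivity ((lam \x lam) (I `*` I) * lam I).
    apply: (@product_measure1E _ _ _ _ R (lam \x lam) lam) => //.
    exact: measurableX.
  congr (_ * _); exact: (@product_measure1E _ _ _ _ R lam lam).
by rewrite lebesgue_measure_itv/= lte_fin ifT ?ltry//; lra.
Qed.

Let solid_angle_fin : fin_num_fun (@solid_angle R).
Proof.
move=> A mA; rewrite fin_numM// ge0_fin_numE//; exact: leb3_cone_lty.
Qed.

HB.instance Definition _ := Measure_isFinite.Build _ _ _ (@solid_angle R)
  solid_angle_fin.

End solid_angle_finite.

Section radial_measure.
Local Open Scope ereal_scope.
Context (R : realType).
Notation lam := (@lebesgue_measure R).

(** The radial factor r^2 of Lebesgue measure in polar coordinates. The cutoff to ]0, b] makes the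
    resulting measure finite and removes the negative radii. *)
Definition radial_density (b r : R) : R := (r ^+ 2 * \1_(`]0%R, b]%classic : set R) r)%R.

Lemma radial_density_ge0 b r : (0 <= radial_density b r)%R.
Proof. by rewrite mulr_ge0// sqr_ge0. Qed.

Lemma measurable_radial_density b :
  measurable_fun [set: R] (radial_density b).
Proof. by apply: measurable_funM => //; exact: measurable_funX. Qed.

Definition radial_measure (b : R) (A : set (measurableTypeR R)) : \bar R :=
  \int[lam]_(r in A) (radial_density b r)%:E.

Section isMeasure.
Variable b : R.

Let radial0 : radial_measure b set0 = 0.
Proof. exact: integral_set0. Qed.

Let radial_ge0 A : 0 <= radial_measure b A.
Proof. by apply: integral_ge0 => r _; rewrite lee_fin radial_density_ge0. Qed.

Let radial_sigma_additive : semi_sigma_additive (radial_measure b).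
Proof.
move=> F mF tF mUF; rewrite /radial_measure; apply: cvg_toP.
  apply: ereal_nondecreasing_is_cvgn => m n mn.
  by apply: lee_sum_nneg_natr => // k _ _; exact: radial_ge0.
rewrite ge0_integral_bigcup//=.
- apply: measurable_funTS; apply: measurableT_comp => //.
  exact: measurable_radial_density.
- by move=> r _; rewrite lee_fin radial_density_ge0.
Qed.

HB.instance Definition _ := isMeasure.Build _ _ _ (radial_measure b)
  radial0 radial_ge0 radial_sigma_additive.

Lemma integrable_radial_density :
  lam.-integrable setT (EFin \o radial_density b).
Proof.
have -> : EFin \o radial_density b =
    (EFin \o (fun r : R => r ^+ 2)%R) \_ `]0%R, b].
  apply/funext => r; rewrite patchE /radial_density/= indicE.
  by case: ifPn; rewrite ?mulr1 ?mulr0.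
apply/(integrable_mkcond _ _).1 => //.
apply: measurable_bounded_integrable => //.
- by rewrite /= lebesgue_measure_itv/=; case: ifPn => _; rewrite ?ltry.
- exists (b ^+ 2)%R; split; first by rewrite num_real.
  move=> M bM r /=; rewrite in_itv/= => /andP[r0 rb].
  by rewrite (le_trans _ (ltW bM))// ger0_norm ?sqr_ge0//; nra.
Qed.

Let radial_fin : fin_num_fun (radial_measure b).
Proof.
move=> A mA; apply: integrable_fin_num => //.
exact: (integrableS _ _ (@subsetT _ _) integrable_radial_density).
Qed.

HB.instance Definition _ := Measure_isFinite.Build _ _ _ (radial_measure b)
  radial_fin.

End isMeasure.

Lemma radial_measure_dominated b : radial_measure b `<< lam.
Proof.
apply/null_content_dominatesP => A mA A0; apply: null_set_integral => //.
by apply/measurable_funTS/measurableT_comp => //; exact: measurable_radial_density.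
Qed.

(** The Radon-Nikodym derivative of the radial measure is almost everywhere the radial density,
    since the two have the same integral over every measurable set. *)
Lemma integral_radial_measure b (f : measurableTypeR R -> \bar R) :
  (radial_measure b).-integrable setT f ->
  \int[radial_measure b]_r f r = \int[lam]_r (f r * (radial_density b r)%:E).
Proof.
move=> intf.
rewrite -(Radon_Nikodym_change_of_variables (radial_measure_dominated b))//.
have mf := measurable_int _ intf.
apply: ae_eq_integral => //.
- apply: emeasurable_funM => //; apply: (measurable_int lam).
  by apply: Radon_Nikodym_integrable; exact: radial_measure_dominated.
- apply: emeasurable_funM => //; apply/measurableT_comp => //.
  exact: measurable_radial_density.
- apply: ae_eqe_mul2l; apply: integral_ae_eq => //=.
  + by apply: Radon_Nikodym_integrable; exact: radial_measure_dominated.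
  + by apply/measurableT_comp => //; exact: measurable_radial_density.
  + move=> E _ mE; rewrite -Radon_Nikodym_integral//=.
    exact: radial_measure_dominated.
Qed.

Lemma integral_sqr (x y : R) : (0 <= x)%R -> (x < y)%R ->
  \int[lam]_(r in `]x, y]) (r ^+ 2)%:E = ((y ^+ 3 - x ^+ 3) / 3)%:E.
Proof.
move=> x0 xy; rewrite integral_itv_obnd_cbnd; last first.
  by apply/measurable_EFinP/measurable_funTS; exact: measurable_funX.
have dF (r : R) : is_derive r (1%R : R) (fun r : R => 3^-1 * r ^+ 3)%R (r ^+ 2)%R.
  by apply: is_derive_eq; rewrite /GRing.scale/=; field.
have cF : continuous (fun r : R => 3^-1 * r ^+ 3)%R.
  by move=> r; apply: differentiable_continuous; apply/derivable1_diffP; exact: ex_derive.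
rewrite (@continuous_FTC2 _ _ (fun r : R => 3^-1 * r ^+ 3)%R)//.
- by rewrite -EFinB; congr EFin; ring.
- by apply: continuous_subspaceT => r; exact: exprn_continuous.
- split.
  + by move=> r _; exact: ex_derive.
  + by apply: cvg_at_right_filter; exact: cF.
  + by apply: cvg_at_left_filter; exact: cF.
- by move=> r _; rewrite derive1E; exact: derive_val.
Qed.

Lemma radial_measure_itv (b x y : R) :
  radial_measure b `]x, y] =
    (if Num.max x 0 < Num.min y b then
      ((Num.min y b) ^+ 3 - (Num.max x 0) ^+ 3) / 3 else 0)%R%:E.
Proof.
rewrite /radial_measure.
have -> : \int[lam]_(r in `]x, y]) (radial_density b r)%:E =
    \int[lam]_(r in `](Num.max x 0)%R, (Num.min y b)]) (r ^+ 2)%:E.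
  rewrite [LHS]integral_mkcond [RHS]integral_mkcond; apply: eq_integral => r _.
  rewrite !patchE !mem_setE !in_itv/= gt_max le_min /radial_density indicE.
  rewrite mem_setE in_itv/=.
  case: (x < r)%R; case: (r <= y)%R; case: (0 < r)%R; case: (r <= b)%R => //=;
  by rewrite ?mulr1 ?mulr0.
case: ifPn => h; first by rewrite integral_sqr// le_max lexx orbT.
by rewrite set_itv_ge ?integral_set0// bnd_simp.
Qed.

End radial_measure.

(** * Polar coordinates *)

Section polar_coordinates.
Local Open Scope ereal_scope.
Context (R : realType) (c : R3 R).
Notation lam := (@lebesgue_measure R).

(* [measurableTypeR R] and not [R]: Lebesgue measure is declared on the former,
   and the two carry different displays. *)
Definition polar (y : R3 R) : R3 R * measurableTypeR R :=
  (direction (y - c)%R, enorm (y - c)%R).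

Definition shell (b : R) : set (R3 R) := [set y | 0 < enorm (y - c) <= b]%R.

Let measurable_translation : measurable_fun [set: R3 R] (fun y => y - c)%R.
Proof.
apply/measurable_fun_pairP; split; first apply/measurable_fun_pairP; try split.
- apply: measurable_funB => //; exact: (measurableT_comp measurable_fst measurable_fst).
- apply: measurable_funB => //; exact: (measurableT_comp measurable_snd measurable_fst).
- apply: measurable_funB => //; exact: measurable_snd.
Qed.

Lemma measurable_polar : measurable_fun [set: R3 R] polar.
Proof.
apply/measurable_fun_pairP; split.
- exact: (measurableT_comp (@measurable_direction R) measurable_translation).
- exact: (measurableT_comp (@measurable_enorm R) measurable_translation).
Qed.

Lemma measurable_shell b : measurable (shell b).
Proof.
have -> : shell b = polar @^-1` (setT `*` `]0%R, b]).
  by apply/seteqP; split => y; rewrite /shell/= in_itv//= => -[].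
by rewrite -[X in measurable X]setTI; apply: measurable_polar => //; exact: measurableX.
Qed.

Lemma leb3_sector (A : set (R3 R)) (t : R) : measurable A -> (0 <= t)%R ->
  leb3 (polar @^-1` (A `*` `]0%R, t])) = (t ^+ 3 / 3)%:E * solid_angle A.
Proof.
move=> mA; rewrite le_eqVlt => /predU1P[<-|t0].
  rewrite expr0n/= mul0r mul0e set_itv_ge ?bnd_simp ?ltxx// setX0 preimage_set0.
  exact: measure0.
have ti : (0 < t^-1)%R by rewrite invr_gt0.
(* The sector is the cone over [A] inflated by [t] about [c], so its volume is t^3 times that of the
   cone; the factor 1/3 undoes the 3 in [solid_angle]. *)
have -> : polar @^-1` (A `*` `]0%R, t]) =
    (fun y => t^-1 *: (y - c))%R @^-1` (cone A).
  have nE y : ((0 < enorm (t^-1 *: y) <= 1) = (0 < enorm y <= t))%R.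
    by rewrite (enormZ _ (ltW ti)) pmulr_rgt0// mulrC ler_pdivrMr// mul1r.
  apply/seteqP; split => y; rewrite /cone/= in_itv/= directionZ// nE => -[//].
rewrite leb3_affine//; last exact: measurable_cone.
by rewrite /solid_angle exprVn invrK muleA -EFinM; congr (_%:E * _); field.
Qed.

Lemma leb3_polar_rectangle b (A : set (R3 R)) (x y : R) : measurable A ->
  leb3 (polar @^-1` (A `*` `]x, y]) `&` shell b) =
    solid_angle A * radial_measure b `]x, y].
Proof.
move=> mA; rewrite radial_measure_itv.
set x' := Num.max x 0%R; set y' := Num.min y b.
have -> : polar @^-1` (A `*` `]x, y]) `&` shell b = polar @^-1` (A `*` `]x', y']).
  apply/seteqP; split => z; rewrite /shell/= !in_itv/= gt_max le_min.
    by move=> [[? /andP[-> ->]] /andP[-> ->]].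
  by move=> [? /andP[/andP[-> ->] /andP[-> ->]]].
have x'0 : (0 <= x')%R by rewrite le_max lexx orbT.
case: ifPn => [xy|]; last first.
  by move=> h; rewrite set_itv_ge ?bnd_simp// setX0 preimage_set0 mule0; exact: measure0.
have mS t : measurable (polar @^-1` (A `*` `]0%R, t])).
  by rewrite -[X in measurable X]setTI; apply: measurable_polar => //; exact: measurableX.
(* A truncated sector is the difference of two sectors with apex [c], which produces the difference
   of cubes in the radial measure. *)
have -> : polar @^-1` (A `*` `]x', y']) =
    (polar @^-1` (A `*` `]0%R, y'])) `\` (polar @^-1` (A `*` `]0%R, x'])).
  apply/seteqP; split => z /=; rewrite !in_itv/=.
    move=> [Az /andP[xz zy]]; split; first by rewrite zy (le_lt_trans x'0 xz).
    by move=> [_ /andP[_]]; rewrite leNgt xz.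
  move=> [[Az /andP[z0 zy]] h]; split => //; rewrite zy andbT ltNge.
  by apply/negP => zx; apply: h; rewrite z0 zx.
have y'0 : (0 <= y')%R by rewrite (le_trans x'0)// ltW.
have fA : solid_angle A \is a fin_num by exact: fin_num_measure.
rewrite measureD//; last first.
  by rewrite [X in X < _](leb3_sector mA y'0) -(fineK fA) -EFinM ltry.
rewrite setIidr; last first.
  move=> z /=; rewrite !in_itv/= => -[? /andP[-> zx]]; split => //=.
  by rewrite (le_trans zx)// ltW.
rewrite [X in X - _](leb3_sector mA y'0) [X in _ - X](leb3_sector mA x'0).
by rewrite -(fineK fA) -!EFinM -EFinB; congr EFin; field.
Qed.

(** Uniqueness is used twice: the product measure is determined by rectangles A x B, and for fixed A
    both sides are measures in B, determined by half-open intervals. Restricting to the shell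
    matches the cutoff in [radial_measure b]. *)
Lemma leb3_polar b (X : set (R3 R * measurableTypeR R)%type) : measurable X ->
  leb3 (polar @^-1` X `&` shell b) = (@solid_angle R \x radial_measure b) X.
Proof.
move=> mX; apply/esym.
have mpre (Y : set (R3 R * measurableTypeR R)%type) : measurable Y -> measurable (polar @^-1` Y).
  by move=> mY; rewrite -[X in measurable X]setTI; exact: measurable_polar.
apply: (product_measure_unique (m1 := @solid_angle R) (m2 := radial_measure b)
  (m' := pushforward (mrestr (@leb3 R) (measurable_shell b)) polar)) => //.
  exact: measurable_polar.
move=> mpolar A B mA mB.
have mD : measurable (polar @^-1` (A `*` setT) `&` shell b).
  by apply: measurableI; [apply: mpre; exact: measurableX|exact: measurable_shell].
have mn : measurable_fun [set: R3 R]
    ((fun y => enorm (y - c)%R) : R3 R -> measurableTypeR R).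
  exact: (measurableT_comp (@measurable_enorm R) measurable_translation).
have sA0 : (0 <= fine (solid_angle A))%R by exact: fine_ge0.
pose k : {nonneg R} := NngNum sA0.
have fA : solid_angle A \is a fin_num by exact: fin_num_measure.
(* The condition on the direction is absorbed into the restricting set, which leaves a measure in
   the radius alone. *)
have E1 (I : set R) : leb3 (polar @^-1` (A `*` I) `&` shell b) =
    pushforward (mrestr (@leb3 R) mD) ((fun y => enorm (y - c)%R) : R3 R -> measurableTypeR R) I.
  rewrite /pushforward/= /mrestr; congr leb3; apply/seteqP; split=> y /=.
    by move=> [[? ?] ?].
  by move=> [? [[? ?] ?]].
transitivity (mscale k (radial_measure b) B); last first.
  by rewrite /mscale/= fineK.
rewrite /pushforward/= [LHS]E1.
apply: (@measure_unique _ R (measurableTypeR R) (@ocitv R)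
  (fun n => `](- n%:R)%R, n%:R]%classic) _ _ _ _
  (pushforward (mrestr (@leb3 R) mD)
    ((fun y => enorm (y - c)%R) : R3 R -> measurableTypeR R))
  (mscale k (radial_measure b))) => //.
- exact: ocitvI.
- by move=> n; exists (- n%:R, n%:R)%R.
- apply/seteqP; split=> // x _; exists (Num.bound x) => //=.
  have := ltr_bound x; have := ltrNbound x; rewrite in_itv/=; lra.
- move=> _ [[x y] _ <-] /=; rewrite -E1 leb3_polar_rectangle//.
  by rewrite /mscale/= fineK.
- move=> n /=; rewrite -E1 leb3_polar_rectangle//.
  by rewrite -ge0_fin_numE ?mule_ge0// fin_numM// fin_num_measure.
Qed.

End polar_coordinates.

(** * Fubini's theorem on frustums *)

Section frustum_integral.
Local Open Scope ereal_scope.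
Context (R : realType) (c : R3 R).
Notation lam := (@lebesgue_measure R).

Definition ray (z : R3 R * measurableTypeR R) : R3 R := (c + z.2 *: z.1)%R.

Lemma measurable_ray : measurable_fun [set: R3 R * measurableTypeR R] ray.
Proof.
have m2 : measurable_fun [set: R3 R * measurableTypeR R] (fun z => z.2 : R).
  exact: measurable_snd.
apply/measurable_fun_pairP; split; first apply/measurable_fun_pairP; try split.
- apply: measurable_funD => //; apply: measurable_funM => //.
  apply: (measurableT_comp measurable_fst); apply: (measurableT_comp measurable_fst).
  exact: measurable_fst.
- apply: measurable_funD => //; apply: measurable_funM => //.
  apply: (measurableT_comp measurable_snd); apply: (measurableT_comp measurable_fst).
  exact: measurable_fst.
- apply: measurable_funD => //; apply: measurable_funM => //.
  exact: (measurableT_comp measurable_snd measurable_fst).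
Qed.

Lemma polar_ray x r : S2 x -> (0 < r)%R -> polar c (ray (x, r)) = (x, r).
Proof.
move=> x1 r0; rewrite /polar /ray/= addrAC subrr add0r.
by rewrite direction_ray// enorm_ray// ltW.
Qed.

Lemma ray_polar y : (0 < enorm (y - c))%R -> ray (polar c y) = y.
Proof. by move=> y0; rewrite /ray/polar/= scale_direction// addrC subrK. Qed.

(** On unit directions and positive radii [ray] and [polar] are mutually inverse. This turns an
    image into a preimage, which yields measurability. *)
Lemma frustumE (A : set (R3 R)) (I : set R) : A `<=` @S2 R ->
  (forall r, I r -> (0 < r)%R) -> frustum c A I = polar c @^-1` (A `*` I).
Proof.
move=> AS I0; apply/seteqP; split => [y [x Ax [r Ir <-]]|y [/= Ay Iy]].
  change ((A `*` I) (polar c (ray (x, r)))).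
  by rewrite polar_ray//; [exact: AS|exact: I0].
exists (direction (y - c)%R) => //; exists (enorm (y - c)%R) => //.
by rewrite -[LHS]/(ray (polar c y)) ray_polar//; exact: I0.
Qed.

Lemma measurable_frustum (A : set (R3 R)) (I : set R) : A `<=` @S2 R ->
  (forall r, I r -> (0 < r)%R) -> measurable A -> measurable I ->
  measurable (frustum c A I).
Proof.
move=> AS I0 mA mI; rewrite frustumE// -[X in measurable X]setTI.
by apply: measurable_polar => //; exact: measurableX.
Qed.

(** In polar coordinates the sections of [N] are null for r^2 dr in almost every direction; as the
    density is positive on ]0, b], they are null there for dr as well. *)
Lemma ae_ray_null (b : R) (N : set (R3 R)) : measurable N -> leb3 N = 0 ->
  {ae @solid_angle R, forall x,
    {ae lam, forall r, (0 < r <= b)%R -> ~ N (ray (x, r))}}.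
Proof.
move=> mN N0; pose X := ray @^-1` N.
have mX : measurable X.
  by rewrite -[X in measurable X]setTI; exact: measurable_ray.
have X0 : (@solid_angle R \x radial_measure b) X = 0.
  rewrite -(leb3_polar c)//; apply/eqP; rewrite eq_le measure_ge0 andbT -N0.
  apply: le_measure; rewrite ?inE//.
    apply: measurableI; last exact: measurable_shell.
    by rewrite -[X in measurable X]setTI; exact: measurable_polar.
  by move=> y [+ /andP[y0 _]]; rewrite /X/= ray_polar.
have mF := measurable_fun_xsection (radial_measure b) mX.
have /(ae_eq_integral_abs _ measurableT mF) : \int[@solid_angle R]_x
    `|(radial_measure b \o xsection X) x| = 0.
  by rewrite -X0; apply: eq_integral => x _; rewrite gee0_abs.
apply: filterS => x /(_ Logic.I) /= rx0.
have mS : measurable (xsection X x) by exact: measurable_xsection.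
have md : measurable_fun (xsection X x) (EFin \o radial_density b).
  by apply/measurable_funTS/measurableT_comp => //; exact: measurable_radial_density.
have /(ae_eq_integral_abs _ mS md) : \int[lam]_(r in xsection X x)
    `|(EFin \o radial_density b) r| = 0.
  rewrite -rx0; apply: eq_integral => r _.
  by rewrite gee0_abs// lee_fin radial_density_ge0.
apply: filterS => r /= h rb Nr.
have : xsection X x r by rewrite /xsection/= inE.
move=> /h [] /eqP; rewrite /radial_density indicE mem_set ?mulr1.
  by case/andP: rb => r0 _; rewrite gt_eqF// exprn_gt0.
by rewrite /= in_itv.
Qed.

Section integral.
Variables (b M : R) (A : set (R3 R)) (I : set (measurableTypeR R)) (f : R3 R -> R).
Hypotheses (AS : A `<=` @S2 R) (mA : measurable A) (mI : measurable I).
Hypotheses (Ib : forall r, I r -> (0 < r <= b)%R).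
Let C := frustum c A I.
Hypotheses (mf : measurable_fun C f) (fM : forall y, C y -> (`|f y| <= M)%R).

Let I0 r : I r -> (0 < r)%R. Proof. by move=> /Ib /andP[]. Qed.

Let mC : measurable C. Proof. exact: measurable_frustum. Qed.

Let fC := (f \_ C)%R.

Let mfC : measurable_fun [set: R3 R] fC.
Proof. by apply/(measurable_restrictT _ _).1. Qed.

Let fCM y : (`|fC y| <= `|M|)%R.
Proof.
rewrite /fC patchE; case: ifPn => [/set_mem Cy|_]; last by rewrite normr0.
by rewrite (le_trans (fM Cy))// ler_norm.
Qed.

Let Cray x r : A x -> I r -> C (ray (x, r)).
Proof. by move=> Ax Ir; exists x => //; exists r. Qed.

Let fCE x r : A x -> I r -> fC (ray (x, r)) = f (ray (x, r)).
Proof. by move=> Ax Ir; rewrite /fC patchE mem_set//; exact: Cray. Qed.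

Lemma integrable_ray x : A x ->
  lam.-integrable I (fun r => (r ^+ 2 * f (ray (x, r)))%:E).
Proof.
move=> Ax; apply: (@eq_integrable _ _ _ _ _ mI
    (EFin \o (fun r => r ^+ 2 * fC (ray (x, r)))%R)) => //.
  by move=> r /set_mem Ir /=; rewrite fCE.
apply: measurable_bounded_integrable => //.
- apply: (@le_lt_trans _ _ (lam `]0%R, b])); last first.
    by rewrite lebesgue_measure_itv/=; case: ifPn => _; rewrite ?ltry.
  by apply: le_measure; rewrite ?inE// => r /Ib; rewrite /= in_itv.
- apply: measurable_funTS; apply: measurable_funM; first exact: measurable_funX.
  by apply: (measurableT_comp mfC); exact: (measurableT_comp measurable_ray (pair1_measurable _)).
- exists (b ^+ 2 * `|M|)%R; split; first by rewrite num_real.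
  move=> K bK r /Ib /andP[r0 rb] /=; rewrite (le_trans _ (ltW bK))//.
  by rewrite normrM ler_pM// ger0_norm ?sqr_ge0//; nra.
Qed.

(** The integrand in polar coordinates. The indicators are not redundant: [ray] is not injective on
    the whole product, since scaling the direction can be undone by the radius, so [fC] composed
    with [ray] may be nonzero outside A x I. *)
Let g (z : R3 R * measurableTypeR R) : R := (fC (ray z) * (\1_A z.1 * \1_I z.2))%R.

Let mg : measurable_fun [set: R3 R * measurableTypeR R] g.
Proof.
apply: measurable_funM; first exact: (measurableT_comp mfC measurable_ray).
apply: measurable_funM.
  exact: (measurableT_comp (measurable_indic mA) measurable_fst).
exact: (measurableT_comp (measurable_indic mI) measurable_snd).
Qed.

Let gM z : (`|g z| <= `|M|)%R.
Proof.
rewrite /g normrM -[leRHS]mulr1 ler_pM// ger0_norm ?mulr_ge0//.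
Qed.

Let prod_fin (D : set (R3 R * measurableTypeR R)) : measurable D ->
  (@solid_angle R \x radial_measure b) D < +oo.
Proof.
move=> mD; apply: (@le_lt_trans _ _ ((@solid_angle R \x radial_measure b) setT)).
  by apply: le_measure; rewrite ?inE.
rewrite -setXTT [ltLHS]product_measure1E//.
by rewrite -ge0_fin_numE ?mule_ge0// fin_numM// fin_num_measure.
Qed.

Let ig : (@solid_angle R \x radial_measure b).-integrable setT (EFin \o g).
Proof.
apply: measurable_bounded_integrable => //; first exact: prod_fin.
exists `|M|%R; split; first by rewrite num_real.
by move=> K bK z _ /=; rewrite (le_trans _ (ltW bK)).
Qed.

Let FE x : A x -> \int[radial_measure b]_r (g (x, r))%:E =
  \int[lam]_(r in I) (r ^+ 2 * f (ray (x, r)))%:E.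
Proof.
move=> Ax; rewrite (@integral_radial_measure R b (fun r => (g (x, r))%:E)).
  rewrite [RHS]integral_mkcond; apply: eq_integral => r _.
  rewrite patchE /g/= [\1_A x]indicE mem_set// mul1r indicE.
  case: ifPn => [/set_mem Ir|_]; last by rewrite mulr0 mul0e.
  rewrite fCE// mulr1 /radial_density indicE mem_set ?mulr1; last first.
    by rewrite /= in_itv/= Ib.
  by rewrite -EFinM mulrC.
apply: measurable_bounded_integrable => //.
- by rewrite -ge0_fin_numE// fin_num_measure.
- exact: (measurableT_comp mg (pair1_measurable _)).
- exists `|M|%R; split; first by rewrite num_real.
  by move=> K bK z _ /=; rewrite (le_trans _ (ltW bK)).
Qed.

Let FnA x : ~ A x -> \int[radial_measure b]_r (g (x, r))%:E = 0.
Proof.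
move=> nAx; rewrite integral0_eq// => r _.
by rewrite /g/= [\1_A x]indicE memNset// mul0r mulr0.
Qed.

Let GE x : A x -> (\int[lam]_(r in I) (r ^+ 2 * f (ray (x, r))))%R%:E =
  \int[radial_measure b]_r (g (x, r))%:E.
Proof.
move=> Ax; rewrite FE// /Rintegral fineK//.
by apply: integrable_fin_num => //; exact: integrable_ray.
Qed.

Lemma integrable_radial_integral : (@solid_angle R).-integrable A
  (fun x => (\int[lam]_(r in I) (r ^+ 2 * f (ray (x, r))))%R%:E).
Proof.
apply: (@eq_integrable _ _ _ _ _ mA
    (fun x => \int[radial_measure b]_r (g (x, r))%:E)) => //.
  by move=> x /set_mem Ax; rewrite GE.
apply: (integrableS measurableT) => //.
exact: (integrable_fubini_F ig).
Qed.

Lemma integral_frustum :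
  (\int[@solid_angle R]_(x in A) (\int[lam]_(r in I) (r ^+ 2 * f (ray (x, r)))) =
   \int[@leb3 R]_(y in C) f y)%R.
Proof.
rewrite /Rintegral; congr fine.
transitivity (\int[@solid_angle R]_(x in A) \int[radial_measure b]_r (g (x, r))%:E).
  by apply: eq_integral => x /set_mem Ax; rewrite -GE.
transitivity (\int[@solid_angle R]_x \int[radial_measure b]_r (g (x, r))%:E).
  rewrite integral_mkcond; apply: eq_integral => x _; rewrite patchE.
  case: ifPn => // /negP xA; rewrite FnA// => Ax; apply: xA; exact: mem_set.
rewrite [LHS](integral12_prod_meas1 ig).
(* The product measure agrees with the pushforward of volume by [polar] only over radii in ]0, b].
   As [I] lies in that interval, [g] vanishes outside [D] and nothing is lost. *)
pose D : set (R3 R * measurableTypeR R) := setT `*` `]0%R, b]%classic.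
have mD : measurable D by exact: measurableX.
have preD : polar c @^-1` D = shell c b.
  by apply/seteqP; split => y; rewrite /shell /D /polar /= in_itv//= => -[].
transitivity (\int[@solid_angle R \x radial_measure b]_(z in D) (g z)%:E).
  rewrite [RHS]integral_mkcond; apply: eq_integral => z _; rewrite patchE.
  case: ifPn => // /negP zD; have nI : ~ I z.2.
    move=> Iz; apply: zD; rewrite inE /D; split => //=.
    by rewrite in_itv/= Ib.
  by rewrite /g/= (indicE _ I) (memNset nI) !mulr0.
transitivity (\int[pushforward (@leb3 R) (polar c)]_(z in D) (g z)%:E).
  apply: eq_measure_integral => //.
    exact: measurable_polar.
  move=> mp X mX XD; transitivity (leb3 (polar c @^-1` X `&` shell c b)).
    exact/esym/leb3_polar.
  rewrite /pushforward/=; congr leb3; apply/setIidl; rewrite -preD.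
  by move=> y; exact: XD.
have msh := measurable_shell c b.
have shoo : leb3 (shell c b) < +oo.
  have -> : shell c b = polar c @^-1` setT `&` shell c b by rewrite preimage_setT setTI.
  by rewrite leb3_polar// prod_fin.
rewrite integral_pushforward//; last 3 first.
- exact: measurable_polar.
- exact/measurable_EFinP.
- rewrite preD; apply: measurable_bounded_integrable => //.
    by apply: measurable_funTS; apply: (measurableT_comp mg); exact: measurable_polar.
  exists `|M|%R; split; first by rewrite num_real.
  by move=> K bK z _ /=; rewrite (le_trans _ (ltW bK)).
rewrite preD.
have Csh : C `<=` shell c b.
  by rewrite /C frustumE// => y [_ /= /Ib].
rewrite -[in RHS](setIidr Csh) integral_mkcondr; apply: eq_integral => y /set_mem /andP[y0 _].
rewrite /= /g ray_polar// /fC !patchE; case: ifPn => [|_]; last by rewrite mul0r.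
rewrite inE {1}/C frustumE// => -[/= Ay Iy].
by rewrite !indicE !mem_set// !mulr1.
Qed.

End integral.
End frustum_integral.

(** * Integrals over cells *)

Section integral_ae.
Local Open Scope ereal_scope.
Context d (T : measurableType d) (R : realType) (mu : {measure set T -> \bar R}).

Import HBNNSimple.

Let le_sup_sintegral (N : set T) (h k : T -> \bar R) :
  measurable N -> mu N = 0 -> (forall x, 0 <= k x) ->
  (forall x, ~ N x -> h x <= k x) ->
  ereal_sup [set sintegral mu s |
    s in [set s : {nnsfun T >-> R} | forall x, (s x)%:E <= h x]] <=
  ereal_sup [set sintegral mu s |
    s in [set s : {nnsfun T >-> R} | forall x, (s x)%:E <= k x]].
Proof.
move=> mN N0 k0 hk; apply: ge_ereal_sup => _ [s sh <-].
(* Setting [s] to zero on [N] keeps its integral and puts it below [k]: on [N] because [k] is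
   nonnegative, elsewhere because [h] is below [k]. *)
pose s' := proj_nnsfun s (measurableC mN).
apply: ereal_sup_ubound; exists s' => [x|].
  rewrite /s'/= mindicE; have [Nx|Nx] := pselect (N x).
    by rewrite memNset ?mulr0//=; apply/not_notP.
  by rewrite mem_set// mulr1 (le_trans (sh x))// hk.
rewrite -!integralT_nnsfun; apply: ae_eq_integral => //.
- exact/measurable_EFinP.
- exact/measurable_EFinP.
- exists N; split => // x /= /not_implyP[_]; apply: contra_notP => Nx.
  by rewrite mindicE mem_set// mulr1.
Qed.

(* No measurability is required: the integral is defined through suprema of
   integrals of simple functions below the positive and negative parts, which
   are insensitive to null sets. *)
Lemma eq_integral_ae (D : set T) (f g : T -> \bar R) :
  {ae mu, forall x, D x -> f x = g x} ->
  \int[mu]_(x in D) f x = \int[mu]_(x in D) g x.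
Proof.
move=> [N [mN N0 fg]].
have E x : ~ N x -> (f \_ D) x = (g \_ D) x.
  move=> Nx; rewrite !patchE; case: ifPn => // /set_mem Dx.
  by apply: contrapT => h; apply/Nx/fg => /= /(_ Dx).
rewrite /integral; congr (_ - _); apply/eqP; rewrite eq_le; apply/andP;
  by split; apply: (le_sup_sintegral mN N0) => // x Nx; rewrite ?funeposE ?funenegE E.
Qed.

(** The pieces have to cover [D] only up to a null set, as half-open intervals do in a closed one,
    and [F] may be infinite or unspecified on a null set. Almost everywhere, [F] is the sum of the
    [f i] extended by zero. *)
Lemma integral_ae_partition n (D : set T) (I : 'I_n -> set T) (F : T -> \bar R)
    (f : 'I_n -> T -> R) :
  measurable D -> (forall i, measurable (I i)) -> trivIset setT I ->
  (forall i, I i `<=` D) -> (forall i, mu.-integrable (I i) (EFin \o f i)) ->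
  {ae mu, forall x, D x -> exists2 i, I i x & F x = (f i x)%:E} ->
  \int[mu]_(x in D) F x = \sum_(i < n) \int[mu]_(x in I i) (f i x)%:E.
Proof.
move=> mD mI tI ID fI aeF.
rewrite (@eq_integral_ae _ _ (fun x => \sum_(i < n) ((EFin \o f i) \_ (I i)) x)).
  rewrite integral_sum//; last first.
    move=> i; apply: (integrableS measurableT) => //.
    by apply/(integrable_mkcond _ _).1.
  by apply: eq_bigr => i _; rewrite -integral_mkcondr setIidr.
apply: filterS aeF => x h /h [i Ix ->].
rewrite (bigD1 i)//= patchE mem_set// big1 ?adde0// => k ki.
rewrite patchE memNset// => Ikx; move/eqP: ki; apply.
by apply: (tI) => //; exists x.
Qed.

End integral_ae.

(** * Integrals along a ray, cell by cell *)

Section radial_cells.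
Context (R : realType) (Theta : set (R3 R)) (Rmin Rmax : R) (NTheta Nr : nat)
  (Th : 'I_NTheta -> set (R3 R)) (rad : nat -> R) (beta : R).
Hypotheses (hRmin : 0 < Rmin)
  (hPi : standard_partition Theta Rmin Rmax Th Nr rad beta).
Notation lam := (@lebesgue_measure R).

Lemma rad_ge0 k : (k <= Nr)%N -> Rmin <= rad k.
Proof.
elim: k => [_|k IH kN]; first by rewrite (sp_first hPi).
by rewrite (le_trans (IH (ltnW kN)))// ltW// (sp_increasing hPi).
Qed.

Lemma le_rad k l : (k <= l <= Nr)%N -> rad k <= rad l.
Proof.
move=> /andP[kl]; rewrite -(subnK kl); elim: (l - k)%N => [|m IH] mN //.
by rewrite (le_trans (IH (ltnW mN)))// ltW// (sp_increasing hPi).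
Qed.

Definition rad_itv (i : 'I_Nr) : set (measurableTypeR R) := `[rad i, rad i.+1[%classic.

Lemma rad_itv_subset i r : rad_itv i r -> 0 < r <= Rmax.
Proof.
rewrite /rad_itv/= in_itv/= => /andP[ir ri].
rewrite (lt_le_trans hRmin (le_trans (rad_ge0 (ltnW (ltn_ord i))) ir))/=.
by rewrite -(sp_last hPi) (le_trans (ltW ri))// le_rad// ltn_ord/=.
Qed.

Lemma rad_itv_inj i k r : rad_itv i r -> rad_itv k r -> i = k.
Proof.
wlog ik : i k / (i <= k)%N.
  by move=> h; case/orP: (leq_total i k) => ik ir kr; [|symmetry]; exact: h.
move=> + kr; rewrite /rad_itv/= in_itv/= => /andP[_ ri].
move: kr; rewrite /rad_itv/= in_itv/= => /andP[kr _].
apply/val_inj/eqP; rewrite eqn_leq ik/= leqNgt; apply/negP => ki.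
by have := lt_le_trans (le_lt_trans kr ri) (@le_rad i.+1 k _);
  rewrite ltxx ki ltnW//= => /(_ isT).
Qed.

Lemma trivIset_rad_itv : trivIset setT rad_itv.
Proof.
by move=> i k _ _ [r [ir kr]]; exact: rad_itv_inj ir kr.
Qed.

Lemma rad_itv_cover r : Rmin <= r < Rmax -> exists i, rad_itv i r.
Proof.
rewrite -(sp_first hPi) -(sp_last hPi) => /andP[r0 rN].
have : forall k, (k <= Nr)%N -> r < rad k -> exists i, rad_itv i r.
  elim=> [_|k IH kN rk]; first by rewrite ltNge r0.
  have [kr|rk'] := leP (rad k) r; last exact: IH (ltnW kN) rk'.
  by exists (Ordinal kN); rewrite /rad_itv/= in_itv/= kr.
by move=> /(_ Nr (leqnn _) rN).
Qed.

Lemma measurable_rad_itv i : measurable (rad_itv i).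
Proof. exact: measurable_itv. Qed.

(** Serves both radial integrals of the score: [h] is 1 / r for the path length and r^2 times the
    logit for the field term. *)
Lemma Rintegral_radial_cells (V : set R) (h : R -> R) (vh : 'I_Nr -> bool) :
  (forall i, lam.-integrable (rad_itv i) (EFin \o h)) ->
  {ae lam, forall r, forall i, rad_itv i r -> (r \in V) = vh i} ->
  \int[lam]_(r in `[Rmin, Rmax]) (\1_V r * h r) =
  \sum_(i < Nr | vh i) \int[lam]_(r in rad_itv i) h r.
Proof.
move=> hI aeV; rewrite /Rintegral.
rewrite (integral_ae_partition (I := rad_itv) (f := fun i r => (vh i)%:R * h r)).
- rewrite -sum_fine.
    rewrite [RHS]big_mkcond; apply: eq_bigr => i _.
    have [vi|vi] := ifP.
      by congr fine; apply: eq_integral => r _; rewrite mul1r.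
    rewrite [X in fine X = _](_ : _ = 0%E)//.
    by apply: integral0_eq => r _; rewrite mul0r.
  move=> i _; apply: integrable_fin_num; first exact: measurable_rad_itv.
  have := integrableZl (measurable_rad_itv i) (vh i)%:R (hI i).
  by apply: eq_integrable => //; exact: measurable_rad_itv.
- exact: measurable_itv.
- exact: measurable_rad_itv.
- exact: trivIset_rad_itv.
- move=> i r ir; rewrite /= in_itv/=; have /andP[_ ->] := rad_itv_subset ir.
  move: ir; rewrite /rad_itv/= in_itv/= andbT => /andP[+ _].
  by apply: le_trans; exact/rad_ge0/ltnW/ltn_ord.
- move=> i; have := integrableZl (measurable_rad_itv i) (vh i)%:R (hI i).
  by apply: eq_integrable => //; exact: measurable_rad_itv.
(* The half-open cells leave out only the last radius [Rmax], a null set. *)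
have nR : {ae lam, forall r, r != Rmax}.
  exists [set Rmax]; split; [exact: measurable_set1|exact: lebesgue_measure_set1|].
  by move=> r /negP; rewrite negbK => /eqP ->.
have FF : Filter (almost_everywhere lam).
  exact: (@ae_filter_ringOfSetsType _ (measurableTypeR R) R lam).
move: nR aeV; apply: filterS2 => r rR rV; rewrite /= in_itv/= => /andP[r0 r1].
have [i ir] : exists i, rad_itv i r.
  by apply: rad_itv_cover; rewrite r0 lt_neqAle rR.
by exists i => //; rewrite indicE (rV i ir).
Qed.

Lemma Rintegral_inv (x y : R) : 0 < x -> x < y ->
  lam.-integrable `[x, y[ (EFin \o (@GRing.inv R)) /\
  \int[lam]_(r in `[x, y[) r^-1 = ln y - ln x.
Proof.
move=> x0 xy.
have cV : {within `[x, y], continuous (@GRing.inv R)}.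
  apply: continuous_in_subspaceT => r /set_mem; rewrite /= in_itv/= => /andP[xr _].
  by apply: inv_continuous; rewrite gt_eqF// (lt_le_trans x0).
have iV : lam.-integrable `[x, y] (EFin \o (@GRing.inv R)).
  by apply: continuous_compact_integrable => //; exact: segment_compact.
have iV' : lam.-integrable `[x, y[ (EFin \o (@GRing.inv R)).
  by apply: integrableS iV => // r; rewrite /= !in_itv/= => /andP[-> /ltW ->].
split => //; rewrite /Rintegral integral_itv_bndo_bndc; last exact: measurable_int iV'.
rewrite (@continuous_FTC2 _ _ (@ln R))//.
- split.
  + move=> r; rewrite in_itv/= => /andP[xr _].
    by have [] := is_derive1_ln (lt_trans x0 xr).
  + by apply: cvg_at_right_filter; exact: continuous_ln.
  + by apply: cvg_at_left_filter; apply: continuous_ln; exact: lt_trans xy.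
- move=> r; rewrite in_itv/= => /andP[xr _].
  by rewrite derive1E; have [] := is_derive1_ln (lt_trans x0 xr).
Qed.

End radial_cells.

(** * Continuous shapes produced by discrete ones *)

(** Finiteness of [I] makes the union of the closures closed, so it contains the closure of the
    union; a boundary point lies in no selected [U i], as these are open. *)
Lemma boundary_bigcup_open (T : topologicalType) (I : finType) (P : set I)
    (U : I -> set T) : (forall i, open (U i)) ->
  boundary (\bigcup_(i in P) U i) `<=` \bigcup_(i in P) (closure (U i) `\` U i).
Proof.
move=> oU y [cy ny].
have nU i : P i -> ~ U i y.
  move=> Pi Uy; apply: ny.
  by apply: (filterS (P := U i)) (open_nbhs_nbhs _) => //; exists i.
have : (\bigcup_(i in P) closure (U i)) y.
  move: cy; rewrite closureEbigcap; apply; split.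
    by apply: (closed_bigcup finite_finset) => i _; exact: closed_closure.
  by move=> z [i Pi Uz]; exists i => //; exact: subset_closure.
by move=> [i Pi Cy]; exists i => //; split => //; exact: nU.
Qed.

Lemma negligible_bigcup_fin d (T : measurableType d) (R : realType)
    (mu : {measure set T -> \bar R}) (I : finType) (B : I -> set T) :
  (forall i, mu.-negligible (B i)) -> mu.-negligible (\bigcup_i B i).
Proof.
move=> B0; have : {ae mu, forall x, forall i, ~ B i x}.
  apply: filter_forall => i; apply: negligibleS (B0 i) => x /=.
  by move/contrapT.
by apply: negligibleS => x [i _ Bx] /= /(_ i); apply.
Qed.

(** * Open sectors, their closures, and null sets in polar coordinates *)

Section enorm_topology.
Context (R : realType) (c : R3 R).

Lemma continuous_enorm : continuous (@enorm R).
Proof.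
move=> y; have sqr_cvg (f : R3 R -> R) : f z @[z --> y] --> f y ->
    f z ^+ 2 @[z --> y] --> f y ^+ 2.
  exact: (@continuous_cvg _ _ _ _ _ f (fun t : R => t ^+ 2) (f y)
    (@exprn_continuous R 2 (f y))).
have sqrt_cvg (f : R3 R -> R) : f z @[z --> y] --> f y ->
    Num.sqrt (f z) @[z --> y] --> Num.sqrt (f y).
  exact: (@continuous_cvg _ _ _ _ _ f (@Num.sqrt R) (f y)
    (@sqrt_continuous R (f y))).
apply: (sqrt_cvg (fun z => z.1.1 ^+ 2 + z.1.2 ^+ 2 + z.2 ^+ 2)).
have c1 : z.1 @[z --> y] --> y.1 by exact: cvg_fst.
apply: cvgD; first apply: cvgD; apply: sqr_cvg.
- by apply: (@cvg_comp _ _ _ _ fst _ _ _ c1); exact: cvg_fst.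
- by apply: (@cvg_comp _ _ _ _ snd _ _ _ c1); exact: cvg_snd.
- exact: cvg_snd.
Qed.

Lemma continuous_radius : continuous (fun y : R3 R => enorm (y - c)).
Proof.
move=> y; apply: (@continuous_cvg _ _ _ _ _ (fun y : R3 R => y - c) (@enorm R)
  (y - c) (@continuous_enorm (y - c))).
by apply: cvgB; [exact: cvg_id|exact: cvg_cst].
Qed.

Lemma continuous_direction y : 0 < enorm (y - c) ->
  direction (z - c) @[z --> y] --> direction (y - c).
Proof.
move=> y0; apply: cvgZ.
  by apply: cvgV; [rewrite gt_eqF|exact: continuous_radius].
by apply: cvgB; [exact: cvg_id|exact: cvg_cst].
Qed.

(** The open counterpart of a cell: both radial inequalities are strict, and [U] is to be open in
    the sphere. *)
Definition sector (U : set (R3 R)) (a b : R) : set (R3 R) :=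
  [set y | a < enorm (y - c) < b /\ U (direction (y - c))].

Lemma open_sector (U : set (R3 R)) (a b : R) : 0 <= a ->
  @open (subspace (@S2 R)) U -> open (sector U a b).
Proof.
move=> a0 /open_subspaceP[V oV VU].
rewrite openE => y [/andP[ay yb] Uy].
(* [U] is the trace on the sphere of an ambient open set [V]; directions lie on the sphere, so the
   two conditions agree away from [c]. *)
have UV z : 0 < enorm (z - c) -> V (direction (z - c)) <-> U (direction (z - c)).
  move=> z0; have zS : S2 (direction (z - c)) by exact: enorm_direction.
  have /seteqP[VU1 VU2] := VU; split => h.
    by have [] := VU1 _ (conj h zS).
  by have [] := VU2 _ (conj h zS).
have y0 : 0 < enorm (y - c) by exact: le_lt_trans a0 ay.
have h1 := cvgr_gt _ (@continuous_radius y) _ ay.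
have h2 := cvgr_lt _ (@continuous_radius y) _ yb.
have h3 : \forall z \near y, V (direction (z - c)).
  apply: (continuous_direction y0); apply: open_nbhs_nbhs; split => //.
  exact/(UV y y0).2.
have h : nbhs y ([set z | a < enorm (z - c)] `&` [set z | enorm (z - c) < b]
    `&` [set z | V (direction (z - c))]).
  by apply: filterI h3; apply: filterI; [exact: h1|exact: h2].
apply: filterS h => z [[/= az zb] Vz]; split; first by rewrite az.
by apply/(UV z _).1 => //; exact: le_lt_trans a0 az.
Qed.

(** The condition 0 < a keeps the closure away from [c], where [direction] is not continuous;
    elsewhere the conditions pass to the limit. *)
Lemma closure_sector (U : set (R3 R)) (a b : R) y : 0 < a ->
  closure (sector U a b) y -> a <= enorm (y - c) <= b /\
    @closure (subspace (@S2 R)) U (direction (y - c)).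
Proof.
move=> a0 cy.
have ay : a <= enorm (y - c).
  rewrite leNgt; apply/negP => h.
  by have [z [[/andP[+ _] _] /lt_trans h']] := cy _ (cvgr_lt _ (@continuous_radius y) _ h);
    move/h'; rewrite ltxx.
have yb : enorm (y - c) <= b.
  rewrite leNgt; apply/negP => h.
  by have [z [[/andP[_ +] _] /(lt_trans _) h']] := cy _ (cvgr_gt _ (@continuous_radius y) _ h);
    move/h'; rewrite ltxx.
split; first by rewrite ay yb.
have y0 : 0 < enorm (y - c) by exact: lt_le_trans a0 ay.
have yS : S2 (direction (y - c)) by exact: enorm_direction.
move=> B; rewrite /nbhs/= -(nbhs_subspace_in yS) => BW.
have [z [[/andP[az _] Uz] /= Bz]] := cy _ (continuous_direction y0 BW).
exists (direction (z - c)); split => //; apply: Bz.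
exact/enorm_direction/(lt_trans a0 az).
Qed.

Lemma negligible_sector (N : set (R3 R)) (b : R) : 0 <= b ->
  (@solid_angle R).-negligible N ->
  (@leb3 R).-negligible (polar c @^-1` (N `*` `]0, b])).
Proof.
move=> b0 [N' [mN' N'0 NN']].
apply: (negligibleS (A := polar c @^-1` (N' `*` `]0, b]))).
  by move=> y [/NN' ? ?].
apply/negligibleP.
  by rewrite -[X in measurable X]setTI; apply: measurable_polar => //; exact: measurableX.
by rewrite [LHS]leb3_sector// N'0 mule0.
Qed.

Lemma negligible_sphere (r : R) : 0 < r ->
  (@leb3 R).-negligible [set y | enorm (y - c) = r].
Proof.
move=> r0; pose X : set (R3 R * measurableTypeR R) := setT `*` [set r].
have mr : measurable ([set r] : set (measurableTypeR R)) by exact: measurable_set1.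
have mX : measurable X by exact: measurableX.
have -> : [set y | enorm (y - c) = r] = polar c @^-1` X `&` shell c r.
  apply/seteqP; split => y; rewrite /X/shell/polar/=; last by case=> -[].
  by move=> ->; rewrite r0 lexx.
apply/negligibleP.
  apply: measurableI; last exact: measurable_shell.
  by rewrite -[X in measurable X]setTI; exact: measurable_polar.
rewrite [LHS]leb3_polar//.
transitivity (solid_angle [set: R3 R] * radial_measure r [set r])%E.
  exact: product_measure1E.
by rewrite /radial_measure integral_set1 mule0.
Qed.

End enorm_topology.

Section produced_shapes.
Context (R : realType) (c : R3 R) (Theta : set (R3 R)) (Rmin Rmax : R)
  (NTheta Nr : nat) (Th : 'I_NTheta -> set (R3 R)) (rad : nat -> R) (beta : R).
Hypotheses (hTheta : Theta `<=` @S2 R) (hRmin : 0 < Rmin)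
  (hPi : standard_partition Theta Rmin Rmax Th Nr rad beta).

Lemma Th_subset j : Th j `<=` Theta.
Proof.
by case: (sp_partition hPi) => <- _ _ x Tx; exists j.
Qed.

Lemma Th_inj j k x : Th j x -> Th k x -> j = k.
Proof.
case: (sp_partition hPi) => _ tT _ jx kx; apply: tT => //; by exists x.
Qed.

Let S := subspace (@S2 R).
Let Tho j : set (R3 R) := @interior S (Th j).

Let open_Tho j : @open S (Tho j).
Proof. exact: (@open_interior S). Qed.

Let Tho_subset j : Tho j `<=` Th j.
Proof. exact: (@interior_subset S). Qed.

Let boundary_Tho j : @closure S (Tho j) `\` Tho j `<=` boundary_S2 (Th j).
Proof. by move=> x [cx nx]; split => //; exact: (@closureS S _ _ (@Tho_subset j)) cx. Qed.

Let Th_boundary j x : Th j x -> ~ Tho j x -> boundary_S2 (Th j) x.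
Proof. by move=> Tx nx; split => //; exact: (@subset_closure S). Qed.

Let negligible_boundary :
  (@solid_angle R).-negligible (\bigcup_j boundary_S2 (Th j)).
Proof. by apply: negligible_bigcup_fin => j; exact: (sp_boundary hPi). Qed.

Lemma exists_produces2D (qhat : 'I_NTheta -> bool) :
  exists q, produces2D Theta Th qhat q.
Proof.
exists (\bigcup_(j in [set j | qhat j]) Tho j); split; first split.
- by apply: (@bigcup_open S) => j _; exact: open_Tho.
- by move=> x [j _ /Tho_subset]; exact: Th_subset.
- apply: negligibleS negligible_boundary => x.
  by move/(@boundary_bigcup_open S _ _ _ open_Tho) => [j _ /boundary_Tho]; exists j.
(* Off the boundaries, a point of a piece lies in its interior, and disjointness keeps it out of all
   other pieces, so membership in the union is decided by [qhat j]. *)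
apply: negligibleS negligible_boundary => x /= /existsNP[j /not_implyP[Tx]].
move=> xq; exists j => //; apply: Th_boundary => // Thox; apply: xq.
have [qj|/negP qj] := boolP (qhat j).
  by rewrite mem_set//; exists j.
apply/negbTE/negP => /set_mem[k /= qk /Tho_subset Tk].
by apply: qj; rewrite (Th_inj Tx Tk).
Qed.

Let O (ji : 'I_NTheta * 'I_Nr) := sector c (Tho ji.1) (rad ji.2) (rad ji.2.+1).

(** One null set serves two purposes: it contains the boundary of the union of the selected sectors,
    and the points of cells where this union disagrees with [vhat]. *)
Let bad : set (R3 R) := polar c @^-1` (\bigcup_j boundary_S2 (Th j) `*` `]0, Rmax])
  `|` \bigcup_(i : 'I_Nr.+1) [set y | enorm (y - c) = rad i].

Let negligible_bad : (@leb3 R).-negligible bad.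
Proof.
apply: negligibleU.
  apply: negligible_sector => //.
  by rewrite -(sp_last hPi) (le_trans (ltW hRmin))// (rad_ge0 hPi).
apply: negligible_bigcup_fin => i; apply: negligible_sphere.
by rewrite (lt_le_trans hRmin)// (rad_ge0 hPi)// -ltnS.
Qed.

Let rad_gt0 (i : 'I_Nr) : 0 < rad i.
Proof. by rewrite (lt_le_trans hRmin)// (rad_ge0 hPi)// ltnW. Qed.

Let open_O ji : open (O ji).
Proof. by apply: open_sector; [exact: ltW|exact: open_Tho]. Qed.

Lemma exists_produces3D (vhat : 'I_NTheta -> 'I_Nr -> bool) :
  exists v, produces3D (field_of_view c Theta Rmin Rmax) c Th rad vhat v.
Proof.
exists (\bigcup_(ji in [set ji | vhat ji.1 ji.2]) O ji); split; first split.
- by apply: bigcup_open => ji _; exact: open_O.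
- move=> y [[j i] _ [/= /andP[iy yi] /Tho_subset Ty]].
  have y0 := lt_trans (rad_gt0 i) iy.
  exists (direction (y - c)); first exact: Th_subset Ty.
  exists (enorm (y - c)); last by rewrite scale_direction// addrC subrK.
  rewrite /= in_itv/=; apply/andP; split.
    by rewrite (le_trans _ (ltW iy))// (rad_ge0 hPi)// ltnW.
  rewrite -(sp_last hPi) (le_trans (ltW yi))// (le_rad hPi)//.
  by rewrite ltn_ord leqnn.
- apply: negligibleS negligible_bad => y.
  move=> /(boundary_bigcup_open open_O)[[j i] _ [/(closure_sector (rad_gt0 i))]].
  move=> /= [/andP[iy yi] cy] nO.
  have y0 := lt_le_trans (rad_gt0 i) iy.
  (* The Nr cells have Nr + 1 bounding spheres: [widen_ord] gives the index i of the inner one,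
     [lift ord0] the index i + 1 of the outer one. *)
  have [eiy|niy] := eqVneq (enorm (y - c)) (rad i).
    by right; exists (widen_ord (leqnSn _) i).
  have [eyi|nyi] := eqVneq (enorm (y - c)) (rad i.+1).
    by right; exists (lift ord0 i).
  left; split => /=; last first.
    rewrite in_itv/= y0 (le_trans yi)// -(sp_last hPi) (le_rad hPi)//.
    by rewrite ltn_ord leqnn.
  exists j => //; apply: boundary_Tho; split => // Ty; apply: nO; split => //=.
  by rewrite !lt_neqAle iy yi nyi eq_sym niy.
apply: negligibleS negligible_bad => y /= /existsNP[j] /existsNP[i].
move=> /not_implyP[[x Tx [r]]]; rewrite /= in_itv/= => /andP[ir ri] ryE yv.
have r0 := lt_le_trans (rad_gt0 i) ir.
have xS : S2 x by exact: hTheta (Th_subset Tx).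
have [ey dy] : enorm (y - c) = r /\ direction (y - c) = x.
  by rewrite -ryE addrAC subrr add0r direction_ray// enorm_ray// ltW.
(* A cell contains its inner sphere but not its outer one, so only the inner radius separates it
   from the sector. *)
have [eiy|niy] := eqVneq (enorm (y - c)) (rad i).
  by right; exists (widen_ord (leqnSn _) i).
left; split => /=; last first.
  rewrite in_itv/= ey r0 (le_trans (ltW ri))// -(sp_last hPi) (le_rad hPi)//.
  by rewrite ltn_ord leqnn.
exists j => //; apply: Th_boundary; rewrite dy// => Thox; apply: yv.
have [vji|/negP vji] := boolP (vhat j i).
  rewrite mem_set//; exists (j, i) => //; split => /=; last by rewrite dy.
  by rewrite ey ri andbT lt_neqAle eq_sym -ey niy ey.
apply/negbTE/negP => /set_mem[[k l] /= vkl [/= /andP[ly yl] /Tho_subset Tk]].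
apply: vji; rewrite dy in Tk; rewrite (Th_inj Tx Tk).
rewrite (@rad_itv_inj _ _ _ _ _ _ _ _ _ hPi i l r) ?/rad_itv/= ?in_itv/= ?ir ?ri//.
by rewrite -ey yl ltW.
Qed.

End produced_shapes.

(** * The score of the produced shapes *)

Section auxiliary.
Context (R : realType).

Lemma Rintegral_sum d (T : measurableType d) (mu : {measure set T -> \bar R})
    (D : set T) (I : finType) (P : pred I) (f : I -> T -> R) : measurable D ->
  (forall i, mu.-integrable D (EFin \o f i)) ->
  \int[mu]_(x in D) (\sum_(i | P i) f i x) = \sum_(i | P i) \int[mu]_(x in D) f i x.
Proof.
move=> mD fI; rewrite /Rintegral sum_fine; last first.
  by move=> i _; apply: integrable_fin_num => //; exact: fI.
rewrite -(integral_sum mD fI); congr fine; apply: eq_integral => x _.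
by rewrite sumEFin.
Qed.

Lemma bigmaxe_eq (I : finType) (g : I -> \bar R) (k : I) :
  (forall i, (g i <= g k)%E) -> (\big[maxe/-oo]_i g i)%E = g k.
Proof.
move=> gk; apply/eqP; rewrite eq_le; apply/andP; split.
  by apply: bigmax_le => //; exact: leNye.
exact: le_bigmax.
Qed.

Lemma measurable_logit (Omega : set (R3 R)) (B : bernoulli_field Omega) :
  measurable_fun Omega (logit B).
Proof.
have mB := measurable_rate B.
apply: (eq_measurable_fun (fun x => ln (B x) - ln (1 - B x))).
  move=> x /set_mem /(rate_in01 B) /andP[p0 p1].
  by rewrite /logit ln_div// ?posrE ?subr_gt0.
apply: measurable_funB; apply: (measurableT_comp (@measurable_ln R)) => //.
exact: measurable_funB.
Qed.

Lemma bounded_logitP (Omega : set (R3 R)) (B : bernoulli_field Omega) :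
  exists M, forall x, Omega x -> `|logit B x| <= M.
Proof.
have [M [_ BM]] := bounded_logit B.
by exists (M + 1) => x; apply: BM; rewrite ltrDl.
Qed.

Lemma log_proj_fin_or_ninfty (alpha : R) q l :
  log_proj alpha q l \is a fin_num \/ q /\ log_proj alpha q l = -oo%E.
Proof.
rewrite /log_proj; case: q; last by left.
by rewrite /=; case: ifPn => _; [right|left].
Qed.

End auxiliary.

Section score_of_produced_shapes.
Context (R : realType) (c : R3 R) (Theta : set (R3 R))
    (Rmin Rmax alpha lam : R) (J : R)
    (NTheta : nat) (Th : 'I_NTheta -> set (R3 R))
    (Nr : nat) (rad : nat -> R) (beta : R)
    (Yf : 'I_NTheta -> R) (YH : 'I_NTheta -> 'I_Nr -> R)
    (psi : 'I_NTheta -> 'I_Nr.+1 -> {set 'I_Nr}).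
Hypotheses
    (hTheta : Theta `<=` @S2 R)
    (hRmin : 0 < Rmin)
    (hPi : standard_partition Theta Rmin Rmax Th Nr rad beta)
    (hpsi : forall j (k : 'I_Nr.+1), k_largest (YH j) k (psi j k)).
Variables (Bf : bernoulli_field Theta)
    (BH : bernoulli_field (field_of_view c Theta Rmin Rmax)).
Hypotheses (hBf : forall j, mean_summary (@solid_angle R) Bf (Th j) = Yf j)
    (hBH : forall j i,
       mean_summary (@leb3 R) BH (cell c Th rad j i) = YH j i).
Variables (nstar : 'I_NTheta -> 'I_Nr.+1) (qhat : 'I_NTheta -> bool)
         (vhat : 'I_NTheta -> 'I_Nr -> bool).
Hypotheses (hnstar : forall j n,
       (region_gain alpha beta lam J (solid_angle (Th j)) (Yf j) (YH j)
          (psi j) n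
        <= region_gain alpha beta lam J (solid_angle (Th j)) (Yf j) (YH j)
             (psi j) (nstar j))%E)
    (hvhat : forall j i, vhat j i = (i \in psi j (nstar j)))
    (hqhat : forall j q,
       (projection_gain alpha beta (solid_angle (Th j)) (Yf j) (nstar j) q
        <= projection_gain alpha beta (solid_angle (Th j)) (Yf j) (nstar j)
             (qhat j))%E).

Notation leb := (@lebesgue_measure R).
Let L j := log_proj alpha (qhat j) ((nstar j)%:R * ln beta).
Let G (i : 'I_Nr) x := \int[leb]_(r in rad_itv rad i) (r ^+ 2 * logit BH (ray c (x, r))).

Let mTh j : measurable (Th j). Proof. exact: (sp_measurable hPi). Qed.

Let mTheta : measurable Theta.
Proof.
by case: (sp_partition hPi) => <- _ _; exact: fin_bigcup_measurable.
Qed.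

Let ThS j : Th j `<=` @S2 R.
Proof. by move=> x /(Th_subset hPi); exact: hTheta. Qed.

Let cell_subset (j : 'I_NTheta) (i : 'I_Nr) :
  frustum c (Th j) (rad_itv rad i) `<=` field_of_view c Theta Rmin Rmax.
Proof.
move=> _ [x Tx [r ir <-]]; exists x; first exact: (Th_subset hPi Tx).
exists r => //; rewrite /= in_itv/=; have /andP[_ ->] := rad_itv_subset hRmin hPi ir.
move: ir; rewrite /rad_itv/= in_itv/= andbT => /andP[+ _].
by apply: le_trans; apply: (rad_ge0 hPi); exact/ltnW/ltn_ord.
Qed.

Let measurable_fov : measurable (field_of_view c Theta Rmin Rmax).
Proof.
apply: measurable_frustum => //.
by move=> r; rewrite /= in_itv/= => /andP[+ _]; exact: lt_le_trans.
Qed.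

Let mlogit_cell (j : 'I_NTheta) (i : 'I_Nr) :
  measurable_fun (frustum c (Th j) (rad_itv rad i)) (logit BH).
Proof. exact: (measurable_funS measurable_fov (@cell_subset j i) (measurable_logit BH)). Qed.

Let rad_itv_ray (j : 'I_NTheta) x (i : 'I_Nr) : Th j x ->
  leb.-integrable (rad_itv rad i) (fun r => (r ^+ 2 * logit BH (ray c (x, r)))%:E).
Proof.
have [M BM] := bounded_logitP BH; move=> Tx.
apply: (@integrable_ray R c Rmax M (Th j) (rad_itv rad i) (logit BH)) => //.
- exact: (@measurable_rad_itv R Nr rad i).
- by move=> r; exact: (rad_itv_subset hRmin hPi).
- by move=> y /cell_subset /BM.
Qed.

Let G_integrable (j : 'I_NTheta) (i : 'I_Nr) : (@solid_angle R).-integrable (Th j) (EFin \o G i).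
Proof.
have [M BM] := bounded_logitP BH.
apply: (@integrable_radial_integral R c Rmax M (Th j) (rad_itv rad i) (logit BH)) => //.
- exact: (@measurable_rad_itv R Nr rad i).
- by move=> r; exact: (rad_itv_subset hRmin hPi).
- by move=> y /cell_subset /BM.
Qed.

Let G_integral (j : 'I_NTheta) (i : 'I_Nr) : \int[@solid_angle R]_(x in Th j) G i x = YH j i.
Proof.
have [M BM] := bounded_logitP BH.
rewrite -hBH; apply: (@integral_frustum R c Rmax M (Th j) (rad_itv rad i) (logit BH)) => //.
- exact: (@measurable_rad_itv R Nr rad i).
- by move=> r; exact: (rad_itv_subset hRmin hPi).
- by move=> y /cell_subset /BM.
Qed.

Let logit_integrable j : (@solid_angle R).-integrable (Th j) (EFin \o logit Bf).
Proof.
have [M BM] := bounded_logitP Bf; apply: measurable_bounded_integrable => //.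
- by rewrite /= -ge0_fin_numE// fin_num_measure.
- by apply: (measurable_funS mTheta _ (measurable_logit Bf)); exact: (Th_subset hPi).
- exists M; split; first by rewrite num_real.
  by move=> K MK x /(Th_subset hPi) /BM /le_trans; apply; exact: ltW.
Qed.

Let sum_ln_beta j : \sum_(i < Nr | vhat j i) \int[leb]_(r in rad_itv rad i) r^-1 =
  (nstar j)%:R * ln beta.
Proof.
have b0 : 0 < beta by exact: lt_trans ltr01 (sp_beta hPi).
transitivity (\sum_(i < Nr | vhat j i) ln beta).
  apply: eq_bigr => i _.
  have r0 : 0 < rad i by rewrite (lt_le_trans hRmin)// (rad_ge0 hPi)// ltnW.
  have [_ ->] := Rintegral_inv r0 (sp_increasing hPi (ltn_ord i)).
  by rewrite (sp_ratio hPi)// lnM ?posrE// addrK.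
rewrite sumr_const [RHS]mulr_natl; congr (_ *+ _).
have [<- _] := hpsi j (nstar j).
by apply: eq_card => i; rewrite -hvhat.
Qed.

(** If [L j] were -oo on a cell of positive solid angle, then [qhat j] would be 1 with gain -oo,
    below the finite gain of q = 0, against the choice of [qhat]. *)
Let L_null j : L j \is a fin_num \/ solid_angle (Th j) = 0%E.
Proof.
have [?|[qj Lj]] := log_proj_fin_or_ninfty alpha (qhat j) ((nstar j)%:R * ln beta).
  by left.
right; have := hqhat j false; rewrite /projection_gain qj -qj Lj.
have [->//|m0] := eqVneq (solid_angle (Th j)) 0%E.
rewrite gt0_muleNy ?lt0e ?m0//= addeNy leeNy_eq.
have fm : solid_angle (Th j) \is a fin_num by exact: fin_num_measure.
by rewrite -(fineK fm) -EFinM -EFinD.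
Qed.

Let mulL j : (solid_angle (Th j) * L j)%E = (fine (solid_angle (Th j)) * fine (L j))%:E.
Proof.
have fm : solid_angle (Th j) \is a fin_num by exact: fin_num_measure.
(* On a null cell both products are 0, by the convention 0 * -oo = 0 on the left and whatever the
   default value of [fine] on the right. *)
case: (L_null j) => [fL|->]; first by rewrite EFinM !fineK.
by rewrite mul0e mul0r.
Qed.

(** The integrand of the score over cell j, made real-valued: [fine (L j)] differs from [L j] only
    on null cells. *)
Let f j x := (qhat j)%:R * logit Bf x + fine (L j) +
  lam / J * \sum_(i < Nr | vhat j i) G i x.

Let f1I j : (@solid_angle R).-integrable (Th j)
  (EFin \o (fun x => (qhat j)%:R * logit Bf x)).
Proof. exact: (integrableZl (mTh j) _ (logit_integrable j)). Qed.

Let cI j : (@solid_angle R).-integrable (Th j) (EFin \o (fun=> fine (L j))).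
Proof.
by apply: finite_measure_integrable_cst.
Qed.

Let sumGI j : (@solid_angle R).-integrable (Th j)
  (EFin \o (fun x => \sum_(i < Nr | vhat j i) G i x)).
Proof.
have := integrable_sum (mTh j) (index_enum 'I_Nr) (P := vhat j)
  (fun i _ => G_integrable j i).
by apply: eq_integrable => // x _; rewrite /= sumEFin.
Qed.

Let f3I j : (@solid_angle R).-integrable (Th j)
  (EFin \o (fun x => lam / J * \sum_(i < Nr | vhat j i) G i x)).
Proof. exact: (integrableZl (mTh j) _ (sumGI j)). Qed.

Let f12I j : (@solid_angle R).-integrable (Th j)
  (EFin \o (fun x => (qhat j)%:R * logit Bf x + fine (L j))).
Proof. exact: (integrableD (mTh j) (f1I j) (cI j)). Qed.

Let fI j : (@solid_angle R).-integrable (Th j) (EFin \o f j).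
Proof. exact: (integrableD (mTh j) (f12I j) (f3I j)). Qed.

Let f_integral j : \int[@solid_angle R]_(x in Th j) f j x =
  (qhat j)%:R * Yf j + fine (solid_angle (Th j)) * fine (L j) +
  lam / J * \sum_(i < Nr | vhat j i) YH j i.
Proof.
rewrite (RintegralD (mTh j) (f12I j) (f3I j)) (RintegralD (mTh j) (f1I j) (cI j)).
rewrite RintegralZl// -hBf Rintegral_cst// RintegralZl// Rintegral_sum//.
congr (_ + _ + _ * _); first by rewrite mulrC.
by apply: eq_bigr => i _; exact: G_integral.
Qed.

Let region_boundE j :
  region_bound alpha beta lam J (solid_angle (Th j)) (Yf j) (YH j) (psi j) =
  (\int[@solid_angle R]_(x in Th j) f j x)%:E.
Proof.
rewrite /region_bound (bigmaxe_eq (hnstar j)) /region_gain (bigmaxe_eq (hqhat j)).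
rewrite /projection_gain -/(L j) mulL f_integral !EFinD; congr (_ + _)%E.
by congr (_ * _)%:E; apply: eq_bigl => i; rewrite -hvhat.
Qed.

Lemma score_produced (q v : set (R3 R)) : produces2D Theta Th qhat q ->
  produces3D (field_of_view c Theta Rmin Rmax) c Th rad vhat v ->
  score alpha lam J Bf BH q v =
  lower_bound alpha beta lam J (log_normalizer (@leb3 R) BH) Th Yf YH psi.
Proof.
move=> [_ aeq] [_ [N [mN N0 Nv]]].
rewrite /score /lower_bound addeC; congr (_ + _)%E.
have aer := ae_ray_null c Rmax mN N0.
(* Cells where [L j] is infinite are null, so their directions join the exceptional set. *)
have aeL : {ae @solid_angle R, forall x, forall j, Th j x -> L j \is a fin_num}.
  apply: filter_forall => j.
  case: (L_null j) => [fL|Tj0]; first exact/aeW.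
  by exists (Th j); split => // x /= /not_implyP[].
rewrite (integral_ae_partition (I := Th) (f := f)) //.
- apply: eq_bigr => j _; rewrite region_boundE /Rintegral fineK//.
  exact: integrable_fin_num.
- by case: (sp_partition hPi).
- by move=> j; exact: (Th_subset hPi).
move: aeq aer aeL; apply: filterS3 => x xq xr xL Tx.
have [j Tjx] : exists j, Th j x.
  by case: (sp_partition hPi) Tx => <- _ _ [j _ Tx]; exists j.
exists j => //; rewrite /f !EFinD (fineK (xL j Tjx)) /L.
(* The trace of [v] on the ray in direction [x]; for almost every [x] it agrees with [vhat j] at
   almost every radius of each cell. *)
pose V : set R := [set r | v (c + r *: x)].
have indV r : \1_v (c + r *: x) = \1_V r :> R by [].
have aeV : {ae leb, forall r, forall i, rad_itv rad i r -> (r \in V) = vhat j i}.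
  have FF : Filter (almost_everywhere leb).
    exact: (@ae_filter_ringOfSetsType _ (measurableTypeR R) R leb).
  move: xr; apply: filterS => r Nr' i ir.
  have cr : cell c Th rad j i (ray c (x, r)) by exists x => //; exists r.
  have := Nr' (rad_itv_subset hRmin hPi ir).
  move/(contra_not (Nv _)) => /= /contrapT /(_ j i cr) <-.
  by apply/idP/idP => /set_mem ?; exact/mem_set.
congr (_ + _ + _)%E.
- by rewrite indicE (xq j Tjx).
- rewrite (xq j Tjx); congr log_proj.
  rewrite -sum_ln_beta /path_length.
  rewrite -(@Rintegral_radial_cells _ _ _ _ _ _ _ _ _ hRmin hPi V _ (vhat j))//.
  move=> i; have r0 : 0 < rad i by rewrite (lt_le_trans hRmin)// (rad_ge0 hPi)// ltnW.
  by have [] := Rintegral_inv r0 (sp_increasing hPi (ltn_ord i)).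
- congr (_ * _)%:E.
  rewrite -(@Rintegral_radial_cells _ _ _ _ _ _ _ _ _ hRmin hPi V _ (vhat j))//.
    by apply: eq_Rintegral => r _; rewrite indV mulrA [_ * \1_V r]mulrC.
  by move=> i; exact: rad_itv_ray Tjx.
Qed.

End score_of_produced_shapes.

Theorem theorem1 (R : realType) (c : R3 R) (Theta : set (R3 R))
    (Rmin Rmax alpha lam : R)
    (K : Type) (H : K * (R3 R -> R3 R)) (J : R)
    (NTheta : nat) (Th : 'I_NTheta -> set (R3 R))
    (Nr : nat) (rad : nat -> R) (beta : R)
    (Yf : 'I_NTheta -> R) (YH : 'I_NTheta -> 'I_Nr -> R)
    (psi : 'I_NTheta -> 'I_Nr.+1 -> {set 'I_Nr})
    (hTheta : Theta `<=` @S2 R)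
    (hRmin : 0 < Rmin) (hRmax : Rmin < Rmax)
    (halpha : alpha < 0) (hlam : 0 < lam)
    (hT : constant_jacobian H.2 J) (hJ : 0 < J)
    (hPi : standard_partition Theta Rmin Rmax Th Nr rad beta)
    (hpsi : forall j (k : 'I_Nr.+1), k_largest (YH j) k (psi j k))
    (Bf : bernoulli_field Theta)
    (BH : bernoulli_field (field_of_view c Theta Rmin Rmax))
    (hBf : forall j, mean_summary (@solid_angle R) Bf (Th j) = Yf j)
    (hBH : forall j i,
       mean_summary (@leb3 R) BH (cell c Th rad j i) = YH j i) :
  let E := score alpha lam J Bf BH in
  let Lmin := lower_bound alpha beta lam J (log_normalizer (@leb3 R) BH)
                Th Yf YH psi in
  (Lmin <= evidence alpha lam J Bf BH)%E /\
  forall (nstar : 'I_NTheta -> 'I_Nr.+1) (qhat : 'I_NTheta -> bool)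
         (vhat : 'I_NTheta -> 'I_Nr -> bool),
    (forall j n,
       (region_gain alpha beta lam J (solid_angle (Th j)) (Yf j) (YH j)
          (psi j) n
        <= region_gain alpha beta lam J (solid_angle (Th j)) (Yf j) (YH j)
             (psi j) (nstar j))%E) ->
    (forall j i, vhat j i = (i \in psi j (nstar j))) ->
    (forall j q,
       (projection_gain alpha beta (solid_angle (Th j)) (Yf j) (nstar j) q
        <= projection_gain alpha beta (solid_angle (Th j)) (Yf j) (nstar j)
             (qhat j))%E) ->
    [/\ exists q, produces2D Theta Th qhat q,
        exists v, produces3D (field_of_view c Theta Rmin Rmax) c Th rad vhat v
      & forall q v, produces2D Theta Th qhat q ->
          produces3D (field_of_view c Theta Rmin Rmax) c Th rad vhat v ->
          E q v = Lmin].
Proof.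
move=> E Lmin; split; last first.
  move=> nstar qhat vhat hn hv hq; split.
  - exact: (exists_produces2D hPi qhat).
  - exact: (exists_produces3D c hTheta hRmin hPi vhat).
  - by move=> q v; exact: (score_produced hTheta hRmin hPi hpsi hBf hBH hn hv hq).
pose gain j := region_gain alpha beta lam J (solid_angle (Th j)) (Yf j) (YH j) (psi j).
(* Maximizers exist because the index types are finite; [ord0] and [true] below merely witness that
   these are inhabited. *)
pose nstar j := [arg max_(n > ord0) gain j n]%O.
pose proj j := projection_gain alpha beta (solid_angle (Th j)) (Yf j) (nstar j).
pose qhat j := [arg max_(q > true) proj j q]%O.
have hn j n : (gain j n <= gain j (nstar j))%E.
  by rewrite /nstar; case: arg_maxP => // k _; exact.
have hq j q : (proj j q <= proj j (qhat j))%E.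
  by rewrite /qhat; case: arg_maxP => // k _; exact.
have [q qq] := exists_produces2D hPi qhat.
have [v vv] := exists_produces3D c hTheta hRmin hPi (fun j i => i \in psi j (nstar j)).
(* The bound is the score of an admissible pair, hence at most the supremum. *)
rewrite /Lmin -(score_produced hTheta hRmin hPi hpsi hBf hBH hn (fun _ _ => erefl) hq qq vv).
apply: ereal_sup_ubound; exists q, v; split => //; [exact: qq.1|exact: vv.1].
Qed.
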